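(* Let $M=(\Omega,P)$ be a Markov chain with countable state space $\Omega$ and transition kernel $P$, and let $(X_n)_{n\geq 0}$ be a trajectory of $M$ started at some state $x\in\Omega$. Suppose there exists a decreasing bijection $\Phi:[0,\infty)\to(0,1]$ such that \[ \int_0^1 \frac{1}{u\,(1\vee \log \Phi^{-1}(u))}\,\mathrm{d}u=\infty \qquad\text{and}\qquad \limsup_{n\to\infty}\frac{\mathbb{G}(X_n,X_m)}{\Phi(n)}<\infty \ \text{ almost surely, for every } m\geq 0, \] where $\Phi^{-1}$ denotes the inverse function of $\Phi$. Then $(X_n)_{n\geq0}$ has infinitely many cut times almost surely. In particular, the same conclusion holds if, almost surely, for each fixed $m\geq 0$ the sequence $(\mathbb{G}(X_n,X_m))_{n\geq 0}$ decays at least polynomially as $n\to\infty$.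
   Context: The Green's function is $\mathbb{G}(x,y)=\sum_{n\geq 0}P^n(x,y)$, the expected number of visits to $y$ of the chain started at $x$. A cut time of a sequence $(x_n)_{n\geq 0}$ is an integer $n\geq 0$ such that the sets $\{x_i:i\leq n\}$ and $\{x_i:i>n\}$ are disjoint. A sequence of non-negative numbers $(a_n)$ decays at least polynomially if there exist $c>0$ and $N$ such that $a_n\leq n^{-c}$ for all $n\geq N$. *)

(* Defs.v *)
From HB Require Import structures.
From mathcomp Require Import all_boot all_order all_algebra.
From mathcomp Require Import all_classical all_reals all_analysis.
Set Implicit Arguments. Unset Strict Implicit. Unset Printing Implicit Defensive.
Import Order.TTheory GRing.Theory Num.Theory.
Local Open Scope classical_set_scope.
Local Open Scope ring_scope.
Local Open Scope ereal_scope.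

Definition stochastic_kernel (R : realType) (Om : countType)
  (P : Om -> Om -> R) : Prop :=
  (forall y z, (0 <= P y z)%R) /\
  (forall y, \esum_(z in [set: Om]) (P y z)%:E = 1).

Fixpoint kpow (R : realType) (Om : countType) (P : Om -> Om -> R)
  (n : nat) (x y : Om) : \bar R :=
  match n with
  | 0 => ((x == y)%:R)%:E
  | k.+1 => \esum_(z in [set: Om]) (kpow P k x z * (P z y)%:E)
  end.

Definition green (R : realType) (Om : countType) (P : Om -> Om -> R)
  (x y : Om) : \bar R :=
  \sum_(0 <= n <oo) kpow P n x y.

Definition markov_trajectory (R : realType) (d : measure_display)
  (T : measurableType d) (Pr : probability T R) (Om : countType)
  (P : Om -> Om -> R) (x : Om) (X : nat -> T -> Om) : Prop :=
  (forall n (y : Om), measurable (X n @^-1` [set y])) /\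
  (forall (n : nat) (xs : nat -> Om),
     Pr [set w | forall i, (i <= n)%N -> X i w = xs i] =
     (((xs 0%N == x)%:R * \prod_(i < n) P (xs i) (xs i.+1))%R)%:E).

Definition cut_time (Om : Type) (s : nat -> Om) (n : nat) : Prop :=
  [set s i | i in [set i | (i <= n)%N]] `&` [set s i | i in [set i | (n < i)%N]]
  = set0.

Definition decays_polynomially (R : realType) (a : nat -> \bar R) : Prop :=
  exists c : R, (0 < c)%R /\ exists N : nat,
    forall n, (N <= n)%N -> a n <= ((n%:R : R) `^ (- c))%:E.

(* Main.v *)
Require Import Defs.
From HB Require Import structures.
From mathcomp Require Import all_boot all_order all_algebra.
From mathcomp Require Import all_classical all_reals all_analysis.
From mathcomp Require Import measurable_realfun zify ring lra.
Set Implicit Arguments.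
Unset Strict Implicit.
Unset Printing Implicit Defensive.
Import Order.TTheory GRing.Theory Num.Theory.
Local Open Scope classical_set_scope.
Local Open Scope ring_scope.
Local Open Scope ereal_scope.

(** Fix a time [n0], put [o = X_n0] and [h y = min 1 (G(y, o))], a superharmonic function.
    Let [I_n] be the minimum of [h (X_i)] over [i <= n] and [a_n = (I_n - I_(n+1)) / I_n].
    If [h (X_i) < I_n] for all [i > n], then [n] is a cut time; by the maximal inequality for
    superharmonic functions this has conditional probability at least [a_n] given
    [X_0, ..., X_(n+1)].  A second moment argument gives a Borel-Cantelli statement: for weights
    [v_n] nonincreasing in [[0, 1]] and thresholds [delta_n] with [v_n * ln (1 / delta_n) <= 1],
    almost surely, if the sum of [v_n a_n] over the [n] with [a_n >= delta_n] diverges, then some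
    [n >= n0] is a cut time.  The covariances are summable because [a_n] is a logarithmic
    derivative of [I]: for fixed [n], the sum over [m > n] of
    [(I_m - I_(m+1)) / (I_n - I_(m+1))] is at most [- ln a_n].

    If there is no cut time after [n0], taking [v = 1], [delta = 1/2] shows that [a_n < 1/2]
    eventually, and taking [v_n] of order [1 / ln n] shows that the sum of [a_n / ln n] converges.
    The latter contradicts the decay of [I_n]: it bounds the integral of the criterion over
    [(I_n / K, 1]] uniformly in [n], and it forces [- ln I_n = o(ln n)]. *)

(** * Sums over countable types and Tonelli's theorem *)

Lemma esum_countE (R : realType) (T : countType) (a : T -> \bar R) :
  (forall z, 0 <= a z) ->
  \esum_(z in [set: T]) a z = \sum_(0 <= k <oo) oapp a 0 (pickle_inv k).
Proof.
move=> a0; set b := fun k => oapp a 0 (pickle_inv k).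
have b0 k : 0 <= b k by rewrite /b; case: pickle_inv => //=.
rewrite nneseries_esumT//.
transitivity (\esum_(k in range (@pickle T)) b k).
  rewrite esum_image; last by move=> i j _ _; exact: (pcan_inj pickleK_inv).
  by apply: eq_esum => z _; rewrite /b pickleK_inv.
rewrite esum_mkcond; apply: eq_esum => k _.
case: ifPn => // /negP kr; rewrite /b.
case E : (pickle_inv k) => [z|] //=; exfalso; apply: kr; rewrite inE.
by exists z => //; have := @pickle_invK T k; rewrite E.
Qed.

Lemma esumZl (R : realType) (T : countType) (k : R) (a : T -> \bar R) :
  (0 <= k)%R -> (forall z, 0 <= a z) ->
  \esum_(z in [set: T]) (k%:E * a z) = k%:E * \esum_(z in [set: T]) a z.
Proof.
move=> k0 a0; rewrite !esum_countE//; last by move=> z; rewrite mule_ge0.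
rewrite -nneseriesZl; last by move=> i _; case: pickle_inv => /=.
by apply: eq_eseriesr => i _; case: pickle_inv => //=; rewrite mule0.
Qed.

Lemma esumC (R : realType) (T1 T2 : choiceType) (a : T1 -> T2 -> \bar R) :
  (forall i j, 0 <= a i j) ->
  \esum_(i in [set: T1]) \esum_(j in [set: T2]) a i j =
  \esum_(j in [set: T2]) \esum_(i in [set: T1]) a i j.
Proof.
move=> a0; rewrite !esum_esum//.
have -> : [set: T1] `*`` (fun=> [set: T2]) = setT by apply/seteqP; split.
have -> : [set: T2] `*`` (fun=> [set: T1]) = setT by apply/seteqP; split.
rewrite (@reindex_esum _ _ _ setT setT (fun p : T2 * T1 => (p.2, p.1)))//.
split=> //= [[i j] [k l] _ _ [-> ->] //|[i j] _]; by exists (j, i).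
Qed.

Lemma integral_esum (R : realType) (d : measure_display) (T : measurableType d)
  (mu : {measure set T -> \bar R}) (D : set T) (I : countType)
  (f : I -> T -> \bar R) :
  measurable D -> (forall i, measurable_fun D (f i)) ->
  (forall i w, 0 <= f i w) ->
  (\int[mu]_(w in D) \esum_(i in [set: I]) f i w) =
  \esum_(i in [set: I]) \int[mu]_(w in D) f i w.
Proof.
move=> mD mf f0.
rewrite esum_countE; last by move=> z; exact: integral_ge0.
under eq_integral do rewrite esum_countE//.
rewrite integral_nneseries//.
- apply: eq_eseriesr => k _; case: pickle_inv => //=.
  by rewrite integral0.
- by move=> k; case: pickle_inv => //=; exact: measurable_cst.
- by move=> k w _; case: pickle_inv => /=.
Qed.

(** * Functionals of finitely many steps, cylinders and the Markov property *)

Definition adapted {Om : Type} {U : Type} (n : nat) (F : (nat -> Om) -> U) : Prop :=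
  forall p q, (forall i, (i <= n)%N -> p i = q i) -> F p = F q.

Lemma adaptedW {Om U : Type} (m n : nat) (F : (nat -> Om) -> U) :
  (m <= n)%N -> adapted m F -> adapted n F.
Proof. by move=> mn aF p q pq; apply: aF => i im; apply: pq; exact: leq_trans mn. Qed.

Section trajectory.
Context (R : realType) (d : measure_display) (T : measurableType d)
  (Pr : probability T R) (Om : countType) (P : Om -> Om -> R) (x : Om)
  (X : nat -> T -> Om).
Hypothesis kP : stochastic_kernel P.
Hypothesis tX : markov_trajectory Pr P x X.

Let path (w : T) : nat -> Om := X^~ w.
Definition cylinder n (s : n.+1.-tuple Om) : set T :=
  [set w | forall i, (i <= n)%N -> X i w = nth x s i].

Lemma measurable_cyl n (s : n.+1.-tuple Om) : measurable (cylinder s).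
Proof.
have -> : cylinder s = \bigcap_(i in `I_n.+1) (X i @^-1` [set nth x s i]).
  by apply/seteqP; split=> w h i /h.
by apply: bigcap_measurable => // [|i _]; [exists 0%N|exact: tX.1].
Qed.

Lemma cyl_cover n w : exists s : n.+1.-tuple Om, cylinder s w.
Proof.
exists [tuple X i w | i < n.+1] => i ile.
by rewrite -[i]/(val (Ordinal (ile : (i < n.+1)%N))) -tnth_nth tnth_mktuple.
Qed.

Lemma cyl_inj n w (s t : n.+1.-tuple Om) : cylinder s w -> cylinder t w -> s = t.
Proof.
move=> sw tw; apply: val_inj; apply: (@eq_from_nth _ x); rewrite ?size_tuple//.
by move=> i ilt; rewrite -sw// tw.
Qed.

Lemma adapted_cyl n U (F : (nat -> Om) -> U) w (s : n.+1.-tuple Om) :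
  adapted n F -> cylinder s w -> F (path w) = F (nth x s).
Proof. by move=> aF sw; apply: aF => i; exact: sw. Qed.

(** The event is a countable union of cylinders. Through this, [adapted], a condition on paths
    alone, stands in for measurability with respect to [X_0, ..., X_n]. *)
Lemma measurable_adapted n U (F : (nat -> Om) -> U) (Y : set U) :
  adapted n F -> measurable [set w | Y (F (path w))].
Proof.
move=> aF.
have -> : [set w | Y (F (path w))] = \bigcup_(s : n.+1.-tuple Om)
    (if `[< Y (F (nth x s)) >] then cylinder s else set0).
  apply/seteqP; split=> [w /= Yw|w [s _]].
    have [s sw] := cyl_cover n w; exists s => //.
    by rewrite asboolT// -(adapted_cyl aF sw).
  by case: asboolP => // Ys sw /=; rewrite (adapted_cyl aF sw).
apply: countable_bigcupT_measurable; first exact: countableP.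
by move=> s; case: ifP => // _; exact: measurable_cyl.
Qed.

Lemma measurable_fun_adapted n d' (U : measurableType d') (F : (nat -> Om) -> U)
  (D : set T) : adapted n F -> measurable_fun D (fun w => F (path w)).
Proof.
move=> aF mD Y mY; apply: measurableI => //.
exact: (measurable_adapted Y aF).
Qed.

Lemma integral_adapted n (F : (nat -> Om) -> \bar R) (A : set T) :
  adapted n F -> (forall p, 0 <= F p) -> measurable A ->
  (\int[Pr]_(w in A) F (path w)) =
  \esum_(s in [set: n.+1.-tuple Om]) (F (nth x s) * Pr (cylinder s `&` A)).
Proof.
move=> aF F0 mA.
have mC := @measurable_cyl n.
transitivity (\int[Pr]_(w in A) \esum_(s in [set: n.+1.-tuple Om])
    (F (nth x s) * (\1_(cylinder s) w)%:E)).
  apply: eq_integral => w _.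
  have [s sw] := cyl_cover n w.
  rewrite (adapted_cyl aF sw) esum_mkcond.
  transitivity (\esum_(t in [set s]) (F (nth x t) * (\1_(cylinder t) w)%:E)).
    by rewrite esum_set1 ?mule_ge0// indicE mem_set// mule1.
  rewrite esum_mkcond; apply: eq_esum => t _; rewrite in_setT.
  case: ifPn => // /negP ts; rewrite indicE memNset ?mule0// => tw.
  by apply: ts; rewrite inE (cyl_inj tw sw).
rewrite integral_esum//; last 2 first.
- move=> s; apply: measurable_funeM; apply/measurable_EFinP.
  exact: measurable_indic.
- by move=> s w; rewrite mule_ge0.
apply: eq_esum => s _.
rewrite ge0_integralZl ?integral_indic//.
by apply/measurable_EFinP; exact: measurable_indic.
Qed.

Lemma cyl_next n (s : n.+1.-tuple Om) (z : Om) :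
  Pr (cylinder s `&` (X n.+1 @^-1` [set z])) = (P (nth x s n) z)%:E * Pr (cylinder s).
Proof.
(* The law of the trajectory is stated for infinite sequences; only the values up to [n + 1] matter,
   so the tail is filled with [z]. *)
pose xs i := if (i <= n)%N then nth x s i else z.
have -> : cylinder s `&` (X n.+1 @^-1` [set z]) =
    [set w | forall i, (i <= n.+1)%N -> X i w = xs i].
  apply/seteqP; split=> [w [sw zw] i|w h].
    by rewrite leq_eqVlt /xs => /predU1P[->|]; [rewrite ltnn|rewrite ltnS => i_le; rewrite i_le; exact: sw].
  split=> [i i_le|/=]; first by rewrite h ?(leq_trans i_le)// /xs i_le.
  by rewrite h// /xs ltnn.
have [_ tX2] := tX; rewrite tX2 /cylinder tX2 -EFinM; congr EFin.
rewrite big_ord_recr /= /xs /= leqnn ltnn mulrA [RHS]mulrC; congr (_ * _)%R.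
by congr (_ * _)%R; apply: eq_bigr => i _; rewrite ltn_ord ltnW.
Qed.

(** Both sides split over the value [z] of [X_(n+1)]. On a cylinder fixing [X_0, ..., X_n] the
    functional [F z] is constant, and [cyl_next] gives the mass of the event [X_(n+1) = z] inside
    it. *)
Lemma markov_step n (F : Om -> (nat -> Om) -> \bar R) :
  (forall z, adapted n (F z)) -> (forall z p, 0 <= F z p) ->
  (\int[Pr]_w F (X n.+1 w) (path w)) =
  \int[Pr]_w \esum_(z in [set: Om]) ((P (X n w) z)%:E * F z (path w)).
Proof.
move=> aF F0; have [P0 _] := kP.
have mX z : measurable (X n.+1 @^-1` [set z]) by exact: tX.1.
have aPF z : adapted n (fun p : nat -> Om => (P (p n) z)%:E * F z p).
  by move=> p q pq; rewrite pq// (aF z p q pq).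
rewrite integral_esum//; last 2 first.
- by move=> z; exact: (@measurable_fun_adapted n _ (\bar R) _ setT (aPF z)).
- by move=> z w; rewrite mule_ge0// lee_fin.
transitivity (\int[Pr]_w \esum_(z in [set: Om])
    (F z (path w) * (\1_(X n.+1 @^-1` [set z]) w)%:E)).
  apply: eq_integral => w _.
  rewrite [RHS]esum_mkcond.
  transitivity (\esum_(z in [set X n.+1 w])
      (F z (path w) * (\1_(X n.+1 @^-1` [set z]) w)%:E)).
    by rewrite esum_set1 ?mule_ge0// indicE mem_set// mule1.
  rewrite esum_mkcond; apply: eq_esum => t _; rewrite in_setT.
  case: ifPn => // /negP ts; rewrite indicE memNset ?mule0// => /= tw.
  by apply: ts; rewrite inE.
rewrite integral_esum//; last 2 first.
- move=> z; apply: emeasurable_funM; first exact: (@measurable_fun_adapted n _ (\bar R) _ setT (aF z)).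
  by apply/measurable_EFinP; exact: measurable_indic.
- by move=> z w; rewrite mule_ge0.
apply: eq_esum => z _.
rewrite (integral_adapted (aPF z))//; last by move=> p; rewrite mule_ge0// lee_fin.
transitivity (\int[Pr]_(w in X n.+1 @^-1` [set z]) F z (path w)).
  rewrite [RHS]integral_mkcond; apply: eq_integral => w _.
  by rewrite patchE indicE; case: ifP; rewrite ?mule1 ?mule0.
rewrite (integral_adapted (aF z))//; apply: eq_esum => s _.
by rewrite cyl_next setIT muleCA muleA.
Qed.

End trajectory.

(** * Expectations of bounded adapted functionals and the maximal inequality *)

Section observables.
Context (R : realType) (d : measure_display) (T : measurableType d)
  (Pr : probability T R) (Om : countType) (P : Om -> Om -> R) (x : Om)
  (X : nat -> T -> Om).
Hypothesis kP : stochastic_kernel P.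
Hypothesis tX : markov_trajectory Pr P x X.

(** The bound makes these functionals integrable, so that expectations are linear and monotone on
    them. *)
Definition obs (U : Type) n (F : (nat -> U) -> R) : Prop :=
  adapted n F /\ exists C : R, forall p, (`|F p| <= C)%R.

Lemma obsW U m n (F : (nat -> U) -> R) : (m <= n)%N -> obs m F -> obs n F.
Proof. by move=> mn [aF bF]; split => //; exact: adaptedW aF. Qed.

Lemma obs_cst U n (c : R) : obs n (fun _ : nat -> U => c).
Proof. by split => //; exists `|c|%R. Qed.

Lemma obsD U n (F G : (nat -> U) -> R) :
  obs n F -> obs n G -> obs n (fun p => F p + G p)%R.
Proof.
move=> [aF [C FC]] [aG [D GD]]; split.
  by move=> p q pq; rewrite (aF p q pq) (aG p q pq).
by exists (C + D)%R => p; rewrite (le_trans (ler_normD _ _))// lerD.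
Qed.

Lemma obsM U n (F G : (nat -> U) -> R) :
  obs n F -> obs n G -> obs n (fun p => F p * G p)%R.
Proof.
move=> [aF [C FC]] [aG [D GD]]; split.
  by move=> p q pq; rewrite (aF p q pq) (aG p q pq).
by exists (C * D)%R => p; rewrite normrM ler_pM.
Qed.

Lemma obsB U n (F G : (nat -> U) -> R) :
  obs n F -> obs n G -> obs n (fun p => F p - G p)%R.
Proof.
move=> [aF [C FC]] [aG [D GD]]; split.
  by move=> p q pq; rewrite (aF p q pq) (aG p q pq).
by exists (C + D)%R => p; rewrite (le_trans (ler_normB _ _))// lerD.
Qed.

Lemma obs_sum U n (F : nat -> (nat -> U) -> R) (a b : nat) :
  (forall i, (a <= i < b)%N -> obs n (F i)) ->
  obs n (fun p => \sum_(a <= i < b) F i p)%R.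
Proof.
elim: b => [|b IH] oF.
  have -> : (fun p => \sum_(a <= i < 0) F i p)%R = (fun _ : nat -> U => 0%R : R).
    by apply/funext => p; rewrite big_geq.
  exact: obs_cst.
have [ab|ba] := leqP a b; last first.
  have -> : (fun p => \sum_(a <= i < b.+1) F i p)%R = (fun _ : nat -> U => 0%R : R).
    by apply/funext => p; rewrite big_geq.
  exact: obs_cst.
have -> : (fun p => \sum_(a <= i < b.+1) F i p)%R =
          (fun p => \sum_(a <= i < b) F i p + F b p)%R.
  by apply/funext => p; rewrite big_nat_recr.
apply: obsD; last by apply: oF; rewrite ab /=.
by apply: IH => i /andP[ai ib]; apply: oF; rewrite ai ltnS ltnW.
Qed.

Lemma obs_unit U n (F : (nat -> U) -> R) :
  adapted n F -> (forall p, 0 <= F p <= 1)%R -> obs n F.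
Proof.
move=> aF F01; split=> //; exists 1%R => p.
by have /andP[F0 F1] := F01 p; rewrite ger0_norm.
Qed.

Definition expect (F : (nat -> Om) -> R) : R := (\int[Pr]_w F (X^~ w))%R.

Lemma obs_integrable n F : obs n F ->
  Pr.-integrable setT (EFin \o (fun w => F (X^~ w))).
Proof.
move=> [aF [C FC]]; apply: measurable_bounded_integrable => //.
- by rewrite ltey_eq fin_num_measure.
- exact: (@measurable_fun_adapted _ _ _ _ _ _ _ _ tX n _ R _ setT aF).
exists C; split; first exact: num_real.
by move=> r Cr w _ /=; rewrite (le_trans (FC _))// ltW.
Qed.

Lemma eq_expect (F G : (nat -> Om) -> R) : F =1 G -> expect F = expect G.
Proof. by move=> FG; apply: eq_Rintegral => w _; rewrite FG. Qed.

Lemma expectD n F G : obs n F -> obs n G ->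
  expect (fun p => F p + G p)%R = (expect F + expect G)%R.
Proof. by move=> oF oG; apply: RintegralD => //; apply: obs_integrable; eassumption. Qed.

Lemma expectB n F G : obs n F -> obs n G ->
  expect (fun p => F p - G p)%R = (expect F - expect G)%R.
Proof. by move=> oF oG; apply: RintegralB => //; apply: obs_integrable; eassumption. Qed.

Lemma expectZ n (c : R) F : obs n F ->
  expect (fun p => c * F p)%R = (c * expect F)%R.
Proof. by move=> oF; apply: RintegralZl => //; apply: obs_integrable; eassumption. Qed.

Lemma le_expect n F G : obs n F -> obs n G -> (forall p, F p <= G p)%R ->
  (expect F <= expect G)%R.
Proof. by move=> oF oG FG; apply: le_Rintegral => //; apply: obs_integrable; eassumption. Qed.

Lemma expect_cst (c : R) : expect (fun=> c) = c.
Proof.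
rewrite /expect Rintegral_cst// [X in fine X](_ : _ = 1) ?mulr1//.
exact: probability_setT.
Qed.

Lemma expect_sum n (F : nat -> (nat -> Om) -> R) (a b : nat) :
  (forall i, (a <= i < b)%N -> obs n (F i)) ->
  expect (fun p => \sum_(a <= i < b) F i p)%R = (\sum_(a <= i < b) expect (F i))%R.
Proof.
elim: b => [|b IH] oF.
  rewrite big_geq// -[RHS]expect_cst; apply: eq_expect => p.
  by rewrite big_geq.
have [ab|ba] := leqP a b; last first.
  by rewrite big_geq// -[RHS]expect_cst; apply: eq_expect => p; rewrite big_geq.
have oF' i : (a <= i < b)%N -> obs n (F i).
  by move=> /andP[ai ib]; apply: oF; rewrite ai ltnS ltnW.
rewrite big_nat_recr//= -IH// -(@expectD n)//; last 2 first.
- exact: obs_sum.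
- by apply: oF; rewrite ab /=.
by apply: eq_expect => p; rewrite big_nat_recr.
Qed.

Lemma expect_indic n (A : (nat -> Om) -> bool) : adapted n A ->
  expect (fun p => (A p)%:R) = fine (Pr [set w | A (X^~ w)]).
Proof.
move=> aA; rewrite /expect /Rintegral; congr fine.
transitivity (\int[Pr]_w (\1_[set w | A (X^~ w)] w)%:E).
  apply: eq_integral => w _; rewrite indicE.
  by case: (boolP (A (X^~ w))) => Aw; [rewrite mem_set|rewrite memNset//; exact/negP].
rewrite integral_indic ?setIT//.
exact: (measurable_adapted tX (fun b : bool => b) aA).
Qed.

Variable h : Om -> R.

Definition below (b : R) (k n : nat) (p : nat -> Om) : bool :=
  all (fun i => h (p i) < b)%R (iota n k.+1).

(* The probability that the chain started at [y] keeps [h < b] up to time [k]. *)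
Fixpoint stay (k : nat) (b : R) (y : Om) : \bar R :=
  ((h y < b)%R%:R)%:E *
  if k is k'.+1 then \esum_(z in [set: Om]) ((P y z)%:E * stay k' b z) else 1.

Lemma belowP b k n p :
  reflect (forall i, (n <= i <= n + k)%N -> (h (p i) < b)%R) (below b k n p).
Proof.
apply: (iffP allP) => H i; first by move=> ni; apply: H; rewrite mem_iota addnS ltnS.
by rewrite mem_iota addnS ltnS; exact: H.
Qed.

Lemma stay_ge0 k b y : 0 <= stay k b y.
Proof.
have [P0 _] := kP.
elim: k y => [|k IH] y /=; apply: mule_ge0; rewrite ?lee_fin ?ler0n//.
by apply: esum_ge0 => z _; apply: mule_ge0; rewrite ?lee_fin.
Qed.

Lemma stay_le1 k b y : stay k b y <= 1.
Proof.
have [P0 P1] := kP.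
elim: k y => [|k IH] y /=; case: (h y < b)%R; rewrite ?mul0e ?mul1e ?lee01//.
rewrite -(P1 y); apply: le_esum => z _.
by rewrite -[leRHS]mule1 lee_wpmul2l ?lee_fin.
Qed.

Lemma stay_fin k b y : stay k b y \is a fin_num.
Proof. by rewrite ge0_fin_numE ?stay_ge0// (le_lt_trans (stay_le1 _ _ _))// ltry. Qed.

(** Induction on the length of the window: the test at time [n] is absorbed into the weight as [F'],
    and one Markov step integrates out [X_(n+1)]. The threshold may depend on the path because it is
    already determined at time [n]. *)
Lemma markov_below k n (b F : (nat -> Om) -> R) :
  adapted n b -> adapted n F -> (forall p, 0 <= F p)%R ->
  (\int[Pr]_w (F (X^~ w) * (below (b (X^~ w)) k n (X^~ w))%:R)%:E) =
  \int[Pr]_w ((F (X^~ w))%:E * stay k (b (X^~ w)) (X n w)).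
Proof.
have [P0 P1] := kP.
elim: k n b F => [|k IH] n b F ab aF F0.
  by apply: eq_integral => w _; rewrite /below /= andbT mule1 EFinM.
pose F' p := (F p * (h (p n) < b p)%R%:R)%R.
have aF' : adapted n F' by move=> p q pq; rewrite /F' (aF p q pq) (ab p q pq) pq.
have F'0 p : (0 <= F' p)%R by rewrite /F' mulr_ge0.
transitivity (\int[Pr]_w (F' (X^~ w) * (below (b (X^~ w)) k n.+1 (X^~ w))%:R)%:E).
  apply: eq_integral => w _; rewrite /F' /below /=.
  by case: (h _ < _)%R; rewrite ?mulr1 ?mulr0 ?mul0r.
rewrite IH; try exact: adaptedW (leqnSn n) _; last by [].
rewrite (@markov_step _ _ _ _ _ _ _ _ kP tX n
  (fun z p => (F' p)%:E * stay k (b p) z)); last 2 first.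
- by move=> z p q pq; rewrite (aF' p q pq) (ab p q pq).
- by move=> z p; apply: mule_ge0; rewrite ?stay_ge0 ?lee_fin.
apply: eq_integral => w _ /=.
under eq_esum do rewrite muleCA.
rewrite esumZl//; last by move=> z; apply: mule_ge0; rewrite ?stay_ge0 ?lee_fin.
by rewrite /F' EFinM muleA.
Qed.

Lemma expect_below k n (b F : (nat -> Om) -> R) :
  adapted n b -> adapted n F -> (forall p, 0 <= F p)%R ->
  expect (fun p => F p * (below (b p) k n p)%:R)%R =
  expect (fun p => F p * fine (stay k (b p) (p n)))%R.
Proof.
move=> ab aF F0; rewrite /expect /Rintegral; congr fine.
rewrite markov_below//; apply: eq_integral => w _.
by rewrite EFinM fineK// stay_fin.
Qed.

Definition superharmonic : Prop :=
  (forall y, 0 <= h y)%R /\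
  forall y, \esum_(z in [set: Om]) (P y z * h z)%:E <= (h y)%:E.

(** Maximal inequality. The induction proves [1 <= stay k b y + h y / b]: if [h y >= b] the second
    term suffices, and otherwise superharmonicity carries the bound through one step of the
    chain. *)
Lemma stay_ge k b y : superharmonic -> (0 < b)%R ->
  (1 - h y / b <= fine (stay k b y))%R.
Proof.
move=> [h0 sh] b0; have [P0 P1] := kP.
suff : 1 <= stay k b y + (h y / b)%:E.
  rewrite -(fineK (stay_fin k b y)) -EFinD lee_fin => {}sh.
  by rewrite lerBlDr.
have hb0 z : (0 <= h z / b)%R by rewrite divr_ge0// ltW.
have large z e : (b <= h z)%R -> 0 <= e -> 1 <= e + (h z / b)%:E.
  move=> bz e0; rewrite -[leLHS]add0e; apply: leeD => //.
  by rewrite lee_fin ler_pdivlMr// mul1r.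
elim: k y => [|k IH] y /=; (have [hyb|/large] := ltP (h y) b; last by apply; rewrite mul0e).
  by rewrite !mule1 leeDl// lee_fin.
rewrite mul1e -(P1 y).
apply: (@le_trans _ _ (\esum_(z in [set: Om])
    ((P y z)%:E * stay k b z + (P y z * (h z / b))%:E))).
  apply: le_esum => z _; rewrite EFinM -ge0_muleDr ?stay_ge0 ?lee_fin//.
  by rewrite -[leLHS]mule1 lee_wpmul2l ?lee_fin.
rewrite esumD; last 2 first.
- by move=> z _; apply: mule_ge0; rewrite ?stay_ge0 ?lee_fin.
- by move=> z _; rewrite lee_fin mulr_ge0.
apply: leeD => //.
under eq_esum do rewrite mulrA mulrC EFinM.
rewrite esumZl; last 2 first.
- by rewrite invr_ge0 ltW.
- by move=> z; rewrite lee_fin mulr_ge0.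
by rewrite mulrC EFinM lee_wpmul2l// lee_fin invr_ge0 ltW.
Qed.

End observables.

(** * The running minimum and the truncated weights *)

Section running_minimum.
Context (R : realType).
Implicit Types (u v delta : nat -> R) (n m k : nat).
Local Open Scope ring_scope.

Fixpoint rmin u n : R := if n is k.+1 then Num.min (rmin u k) (u n) else u 0%N.

(* The relative decrease of the running minimum; it is [0] once the minimum is [0]. *)
Definition decr u n : R := (rmin u n - rmin u n.+1) / rmin u n.

(** The second gate ensures [v n * - ln (decr u n) <= 1] once [v n * - ln (delta n) <= 1], which is
    what makes the covariances summable. *)
Definition weight u n0 v delta n : R :=
  if (n0 <= n)%N && (delta n <= decr u n) then v n * decr u n else 0.

Definition total u n0 v delta n : R := \sum_(0 <= i < n) weight u n0 v delta i.

(** The test uses the total before time [n], so truncation needs no more of the path than the weight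
    itself, and the level [V] is exceeded by at most one weight. *)
Definition cweight u n0 v delta (V : R) n : R :=
  if total u n0 v delta n < V then weight u n0 v delta n else 0.

Lemma rminS_le u n : rmin u n.+1 <= rmin u n.
Proof. by rewrite /= ge_min lexx. Qed.

Lemma rmin_anti u m n : (m <= n)%N -> rmin u n <= rmin u m.
Proof.
elim: n => [|n IH]; first by rewrite leqn0 => /eqP ->.
rewrite leq_eqVlt ltnS => /predU1P[->//|/IH]; exact/le_trans/rminS_le.
Qed.

Lemma rmin_le u n : rmin u n <= u n.
Proof. by case: n => [|n]//=; rewrite ge_min lexx orbT. Qed.

Lemma rmin_le_all u m n : (m <= n)%N -> rmin u n <= u m.
Proof. by move=> /(rmin_anti u) /le_trans; apply; exact: rmin_le. Qed.

Lemma rmin_ge u (b : R) n : (forall i, (i <= n)%N -> b <= u i) -> b <= rmin u n.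
Proof.
elim: n => [|n IH] ub /=; first exact: ub.
by rewrite le_min ub// IH// => i il; rewrite ub// (leq_trans il).
Qed.

Lemma rmin_gt u (b : R) n : (forall i, (i <= n)%N -> b < u i) -> b < rmin u n.
Proof.
elim: n => [|n IH] ub /=; first exact: ub.
by rewrite lt_min ub// IH// => i il; rewrite ub// (leq_trans il).
Qed.

Lemma rmin_ltS u n : rmin u n.+1 < rmin u n -> rmin u n.+1 = u n.+1.
Proof. by rewrite /= minEle; case: ifP => //; rewrite ltxx. Qed.

Lemma rmin_ge0 u n : (forall i, 0 <= u i) -> 0 <= rmin u n.
Proof. by move=> u0; exact: rmin_ge. Qed.

Lemma decr_ge0 u n : (forall i, 0 <= u i) -> 0 <= decr u n.
Proof. by move=> u0; rewrite divr_ge0 ?subr_ge0 ?rminS_le ?rmin_ge0. Qed.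

Lemma decr_le1 u n : (forall i, 0 <= u i) -> decr u n <= 1.
Proof.
move=> u0; rewrite /decr; have := rmin_ge0 n u0; rewrite le_eqVlt => /predU1P[<-|I0].
  by rewrite invr0 mulr0.
by rewrite ler_pdivrMr// mul1r lerBlDr lerDl rmin_ge0.
Qed.

Lemma decr_gt0 u n : (forall i, 0 <= u i) -> 0 < decr u n ->
  [/\ 0 < rmin u n, rmin u n.+1 < rmin u n & rmin u n.+1 = u n.+1].
Proof.
move=> u0 a0; have I0 : 0 < rmin u n.
  rewrite lt_neqAle rmin_ge0// andbT; apply/eqP => I0.
  by move: a0; rewrite /decr -I0 invr0 mulr0 ltxx.
have Il : rmin u n.+1 < rmin u n.
  by move: a0; rewrite /decr pmulr_lgt0 ?invr_gt0// subr_gt0.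
by split=> //; exact: rmin_ltS.
Qed.

Lemma weight_ge0 u n0 v delta n : (forall i, 0 <= u i) -> (forall i, 0 <= v i) ->
  0 <= weight u n0 v delta n.
Proof. by move=> u0 v0; rewrite /weight; case: ifP => // _; rewrite mulr_ge0// decr_ge0. Qed.

Lemma weight_le u n0 v delta n : (forall i, 0 <= u i) -> (forall i, 0 <= v i) ->
  weight u n0 v delta n <= v n * decr u n.
Proof. by move=> u0 v0; rewrite /weight; case: ifP => // _; rewrite mulr_ge0// decr_ge0. Qed.

Section truncated_weights.
Variables (u v delta : nat -> R) (n0 : nat) (V : R).
Hypotheses (u0 : forall i, 0 <= u i) (v01 : forall i, 0 <= v i <= 1)
  (delta0 : forall i, 0 < delta i).
Let v0 i : 0 <= v i. Proof. by case/andP: (v01 i). Qed.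
Let t := weight u n0 v delta.
Let s := cweight u n0 v delta V.

Lemma cweight_ge0 n : 0 <= s n.
Proof. by rewrite /s /cweight; case: ifP => // _; exact: weight_ge0. Qed.

Lemma cweight_le_weight n : s n <= t n.
Proof. by rewrite /s /cweight; case: ifP => // _; exact: weight_ge0. Qed.

Lemma cweight_le n : s n <= v n * decr u n.
Proof. by rewrite (le_trans (cweight_le_weight n))// weight_le. Qed.

Lemma weight_le1 n : t n <= 1.
Proof.
rewrite (le_trans (weight_le _ _ _ _ _))//.
by case/andP: (v01 n) => ? ?; rewrite -[leRHS]mulr1 ler_pM// ?decr_ge0 ?decr_le1.
Qed.

Lemma cweight_gt0 n : 0 < s n -> [/\ 0 < t n, delta n <= decr u n & 0 < decr u n].
Proof.
move=> s0; have t0 : 0 < t n by rewrite (lt_le_trans s0)// cweight_le_weight.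
split=> //; move: t0; rewrite /t /weight; case: ifP; rewrite ?ltxx// => /andP[_ da] _ //.
exact: lt_le_trans da.
Qed.

Lemma total_nondecreasing m n : (m <= n)%N ->
  total u n0 v delta m <= total u n0 v delta n.
Proof.
elim: n => [|n IH]; first by rewrite leqn0 => /eqP ->.
rewrite leq_eqVlt ltnS => /predU1P[->//|/IH] /le_trans; apply.
by rewrite {2}/total big_nat_recr//= lerDl weight_ge0.
Qed.

Lemma sum_cweight_le n : 0 <= V -> \sum_(0 <= i < n) s i <= V + 1.
Proof.
move=> V0.
(* The comparison with [total] is carried along because a new term is added only while [total] is
   below [V]. *)
suff [] : \sum_(0 <= i < n) s i <= V + 1 /\
          \sum_(0 <= i < n) s i <= total u n0 v delta n by [].
elim: n => [|n [IH1 IH2]].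
  by rewrite /total !big_geq//; split => //; rewrite addr_ge0.
rewrite /total big_nat_recr//= [in X in _ /\ X]big_nat_recr//=; split; last first.
  by rewrite lerD// cweight_le_weight.
rewrite {2}/s /cweight; case: ifP => [TV|_]; last by rewrite addr0.
by rewrite lerD// ?weight_le1// (le_trans IH2)// ltW.
Qed.

(** As long as the total is below [V] no weight has been discarded, so both sums agree up to the
    first time that [V] is reached; later terms are nonnegative. *)
Lemma sum_cweight_ge n : V <= total u n0 v delta n ->
  V <= \sum_(0 <= i < n) s i.
Proof.
suff : total u n0 v delta n <= \sum_(0 <= i < n) s i \/
       V <= \sum_(0 <= i < n) s i.
  by move=> [Ts /le_trans|]//; apply.
elim: n => [|n IH].
  by left; rewrite /total !big_geq.
rewrite !big_nat_recr//= /total big_nat_recr//= -/(total u n0 v delta n).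
have [TV|VT] := ltP (total u n0 v delta n) V.
  case: IH => [IH|/le_trans IH].
    by left; rewrite {2}/s /cweight TV lerD.
  by right; apply: IH; rewrite lerDl cweight_ge0.
case: IH => [/(le_trans VT)|] /le_trans IH.
  by right; apply: IH; rewrite lerDl cweight_ge0.
by right; apply: IH; rewrite lerDl cweight_ge0.
Qed.

End truncated_weights.

(* Each summand is [1 - g_m / g_(m+1) <= ln (g_(m+1) / g_m)], where [g_m = I_n - I_m];
   the logarithms telescope. *)
Lemma sum_decr_ratio_le u n M : (forall i, 0 <= u i) -> rmin u n.+1 < rmin u n ->
  (n < M)%N ->
  \sum_(n.+1 <= m < M) (rmin u m - rmin u m.+1) / (rmin u n - rmin u m.+1)
    <= - ln (decr u n).
Proof.
move=> u0 Il nM.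
have In0 : 0 < rmin u n by rewrite (le_lt_trans _ Il)// rmin_ge0.
have g0 m : (n < m)%N -> 0 < rmin u n - rmin u m.
  by move=> nm; rewrite subr_gt0 (le_lt_trans (rmin_anti _ nm)).
have step m : (n < m)%N ->
  (rmin u m - rmin u m.+1) / (rmin u n - rmin u m.+1) <=
  ln (rmin u n - rmin u m.+1) - ln (rmin u n - rmin u m).
  move=> nm; have gm := g0 _ nm; have gm1 : 0 < rmin u n - rmin u m.+1 by rewrite g0// ltnW.
  rewrite -lerN2 opprB -ln_div ?posrE//.
  have -> : - ((rmin u m - rmin u m.+1) / (rmin u n - rmin u m.+1)) =
            (rmin u n - rmin u m) / (rmin u n - rmin u m.+1) - 1.
    by field; rewrite gt_eqF.
  have : 0 < (rmin u n - rmin u m) / (rmin u n - rmin u m.+1) by rewrite divr_gt0.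
  move: (_ / _) => q q0; have := @le_ln1Dx R (q - 1).
  by rewrite (_ : 1 + (q - 1) = q); [apply; rewrite ltrBDr addNr | ring].
have tele : \sum_(n.+1 <= m < M) (rmin u m - rmin u m.+1) / (rmin u n - rmin u m.+1)
    <= ln (rmin u n - rmin u M) - ln (rmin u n - rmin u n.+1).
  elim: M nM => // M IH; rewrite ltnS leq_eqVlt => /predU1P[->|nM].
    by rewrite big_geq// subrr.
  rewrite big_nat_recr//= (le_trans (lerD (IH nM) (step _ nM)))//.
  by rewrite addrC addrA subrK.
(* Since [I_M >= 0], the first logarithm is at most [ln I_n], and what remains is [- ln a_n]. *)
rewrite (le_trans tele)// /decr ln_div ?posrE ?subr_gt0// opprB lerD2r.
by rewrite ler_ln ?posrE ?g0// lerBlDr lerDl rmin_ge0.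
Qed.

End running_minimum.

(** * Second moment estimate for the cut events up to a horizon [M] *)

Section second_moment.
Context (R : realType) (d : measure_display) (T : measurableType d)
  (Pr : probability T R) (Om : countType) (P : Om -> Om -> R) (x : Om)
  (X : nat -> T -> Om).
Hypothesis kP : stochastic_kernel P.
Hypothesis tX : markov_trajectory Pr P x X.
Variables (h : Om -> R) (v delta : nat -> R) (n0 : nat) (V : R) (M : nat).
Hypotheses (sh : superharmonic P h) (v01 : forall i, (0 <= v i <= 1)%R)
  (v_anti : forall m n, (m <= n)%N -> (v n <= v m)%R)
  (delta0 : forall i, (0 < delta i)%R)
  (vdelta : forall i, (v i * - ln (delta i) <= 1)%R)
  (V0 : (0 <= V)%R).
Local Open Scope ring_scope.

Implicit Types p q : nat -> Om.
Let u p : nat -> R := fun i => h (p i).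
Let u0 p i : 0 <= u p i. Proof. exact: sh.1. Qed.
Let v0 i : 0 <= v i. Proof. by case/andP: (v01 i). Qed.
Let s n p := cweight (u p) n0 v delta V n.
(** [e n] is the conditional probability of [cut n] given [X_0, ..., X_(n+1)]; the length [M - n.+1]
    makes the window end exactly at [M]. Dividing by it gives [y n * cut n] the conditional mean
    [s n]. *)
Let e n p : R := fine (stay P h (M - n.+1) (rmin (u p) n) (p n.+1)).
Let y n p : R := s n p / e n p.
Let cut n p : R := (below h (rmin (u p) n) (M - n.+1) n.+1 p)%:R.
Let E := expect Pr X.

Let adapted_rmin n : adapted n (fun p => rmin (u p) n).
Proof.
elim: n => [|n IH] p q pq /=; first by rewrite /u pq.
by rewrite /u pq//; congr Num.min; apply: IH => i il; rewrite pq// (leq_trans il).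
Qed.

Let adapted_decr n : adapted n.+1 (fun p => decr (u p) n).
Proof.
move=> p q pq; rewrite /decr (adapted_rmin pq).
by rewrite (@adapted_rmin n p q)// => i il; rewrite pq// (leq_trans il).
Qed.

Let adapted_weight n : adapted n.+1 (fun p => weight (u p) n0 v delta n).
Proof. by move=> p q pq; rewrite /weight (adapted_decr pq). Qed.

Lemma adapted_total n : adapted n (fun p => total (u p) n0 v delta n).
Proof.
move=> p q pq; rewrite /total !big_nat; apply: eq_bigr => i /= il.
by apply: adapted_weight => j ji; apply: pq; rewrite (leq_trans ji).
Qed.

Let adapted_s n : adapted n.+1 (s n).
Proof.
move=> p q pq; rewrite /s /cweight (adapted_weight pq).
by rewrite (@adapted_total n p q)// => i il; rewrite pq// (leq_trans il).
Qed.

Let adapted_y n : adapted n.+1 (y n).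
Proof.
move=> p q pq; rewrite /y (adapted_s pq) /e pq//.
by rewrite (@adapted_rmin n p q)// => i il; rewrite pq// (leq_trans il).
Qed.

Lemma adapted_below n k (b : (nat -> Om) -> R) : adapted (n + k) b ->
  adapted (n + k) (fun p => below h (b p) k n p).
Proof.
move=> ab p q pq; rewrite (ab p q pq).
by apply/belowP/belowP => H i /andP[ni ik]; [rewrite -pq|rewrite pq]; rewrite ?H ?ni.
Qed.

Let adapted_cut n : (n < M)%N -> adapted M (cut n).
Proof.
move=> nM p q pq; rewrite /cut; congr (nat_of_bool _)%:R.
have := @adapted_below n.+1 (M - n.+1) (fun p => rmin (u p) n).
by rewrite subnKC//; apply => //; apply: adaptedW (@adapted_rmin n); exact: ltnW.
Qed.

Let s_ge0 n p : 0 <= s n p. Proof. exact: cweight_ge0. Qed.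

Let s_le n p : s n p <= v n * decr (u p) n. Proof. exact: cweight_le. Qed.

Let e_ge0 n p : 0 <= e n p. Proof. by rewrite fine_ge0// stay_ge0. Qed.

(** A positive decrease means that the new minimum is [h (X_(n+1))], so the maximal inequality at
    level [I_n] gives exactly [1 - I_(n+1) / I_n = a_n]. *)
Let decr_le_e n p : 0 < decr (u p) n -> decr (u p) n <= e n p.
Proof.
move=> /(decr_gt0 (u0 p))[I0 _ Iu].
rewrite (le_trans _ (stay_ge kP _ _ sh I0))// /decr -[h _]Iu.
by rewrite mulrBl divff ?gt_eqF.
Qed.

(** Division by [e n] is harmless: a positive [s n] forces [0 < a_n <= e n], and otherwise both
    sides are 0. *)
Let y_e n p : y n p * e n p = s n p.
Proof.
have := s_ge0 n p; rewrite /y le_eqVlt => /predU1P[<-|sp]; first by rewrite !mul0r.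
have [_ _ a0] := cweight_gt0 (u0 p) v01 delta0 sp.
by rewrite divfK// gt_eqF// (lt_le_trans a0)// decr_le_e.
Qed.

Let y_ge0 n p : 0 <= y n p. Proof. by rewrite divr_ge0. Qed.

Let y_gt0 n p : 0 < y n p -> 0 < s n p.
Proof.
move=> yp; rewrite lt_neqAle s_ge0 andbT; apply/eqP => s0.
by move: yp; rewrite /y -s0 mul0r ltxx.
Qed.

Let y_le n p : y n p <= v n.
Proof.
have := y_ge0 n p; rewrite le_eqVlt => /predU1P[<-//|/y_gt0 sp].
have [_ _ a0] := cweight_gt0 (u0 p) v01 delta0 sp.
have ae := decr_le_e a0; rewrite /y ler_pdivrMr ?(lt_le_trans a0)//.
by rewrite (le_trans (s_le _ _))// ler_wpM2l.
Qed.

Let y01 n p : 0 <= y n p <= 1.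
Proof. by rewrite y_ge0 (le_trans (y_le _ _))//; case/andP: (v01 n). Qed.

Let s01 n p : 0 <= s n p <= 1.
Proof.
rewrite s_ge0 (@le_trans _ _ (weight (u p) n0 v delta n))//.
  exact: cweight_le_weight.
exact: weight_le1.
Qed.

Let cut01 n p : 0 <= cut n p <= 1.
Proof. by rewrite /cut; case: below; rewrite ?lexx ?ler01. Qed.

Let obs_s n : obs n.+1 (s n). Proof. exact: obs_unit. Qed.
Let obs_y n : obs n.+1 (y n). Proof. exact: obs_unit. Qed.
Let obs_cut n : (n < M)%N -> obs M (cut n).
Proof. by move=> nM; apply: obs_unit => //; exact: adapted_cut. Qed.

Let E_cut n (F : (nat -> Om) -> R) : obs n.+1 F -> (forall p, 0 <= F p) ->
  E (fun p => F p * cut n p) = E (fun p => F p * e n p).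
Proof.
move=> [aF _] F0; apply: (expect_below kP tX h _ _ aF F0).
by apply: adaptedW (@adapted_rmin n).
Qed.

Let E_ycut n : E (fun p => y n p * cut n p) = E (s n).
Proof. by rewrite E_cut//; apply: eq_expect => p; rewrite y_e. Qed.

(** Centred given [X_0, ..., X_(n+1)]. When [cut n] fails its value is [- s n], so a lack of cuts
    drives the sum far below its mean. *)
Let D n p := y n p * cut n p - s n p.

Let obs_D n : (n < M)%N -> obs M (D n).
Proof.
move=> nM; apply: obsB; last exact: obsW (obs_s n).
by apply: obsM; [exact: obsW (obs_y n)|exact: obs_cut].
Qed.

Let E_sqrD n : (n < M)%N -> E (fun p => D n p * D n p) <= 2 * E (s n).
Proof.
move=> nM; have -> : 2 * E (s n) = E (fun p => y n p * cut n p + s n p).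
  rewrite /E (@expectD _ _ _ _ _ _ _ _ tX M) -/E ?E_ycut ?mulr_natl//.
  - by apply: obsM; [exact: obsW (obs_y n)|exact: obs_cut].
  - exact: obsW (obs_s n).
apply: (@le_expect _ _ _ _ _ _ _ _ tX M).
- by apply: obsM; exact: obs_D.
- apply: obsD; last exact: obsW (obs_s n).
  by apply: obsM; [exact: obsW (obs_y n)|exact: obs_cut].
move=> p; rewrite /D; have := y01 n p; have := cut01 n p; have := s01 n p.
move=> /andP[? ?] /andP[? ?] /andP[? ?].
(* For [z] and [s] in [[0, 1]], [(z - s)^2 <= z + s]. *)
have : 0 <= y n p * cut n p <= 1 by rewrite mulr_ge0//= mulr_ile1.
by move: (y n p * cut n p) => z /andP[? ?]; nra.
Qed.

Let ratio n m p : R :=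
  (rmin (u p) m - rmin (u p) m.+1) / (rmin (u p) n - rmin (u p) m.+1).

(** The window runs from [n + 1] to [m + 1]. In [cut_split] it shares time [m + 1] with the
    remaining window, because [stay] also tests its starting state. *)
Let cut_part n m p : bool := below h (rmin (u p) n) (m - n) n.+1 p.

Let cut_split n m p : (n < m < M)%N ->
  below h (rmin (u p) n) (M - n.+1) n.+1 p =
  cut_part n m p && below h (rmin (u p) n) (M - m.+1) m.+1 p.
Proof.
move=> /andP[nm mM]; apply/belowP/andP => [H|[/belowP H1 /belowP H2] i].
  split; apply/belowP => i /andP[ni im]; apply: H; rewrite ?ni/=; lia.
by move=> /andP[ni im]; have [?|?] := leqP i m; [apply: H1|apply: H2]; lia.
Qed.

(** If [cut m] holds, all later values are below [I_m <= I_n], so [cut n] only has to be tested up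
    to time [m + 1]. *)
Let cut_nested n m p : (n < m < M)%N ->
  cut n p * cut m p = (cut_part n m p)%:R * cut m p.
Proof.
move=> nmM; rewrite /cut (cut_split p nmM).
case: (cut_part n m p) => /=; last by rewrite !mul0r.
case: (boolP (below h (rmin (u p) m) _ _ p)) => [/belowP bm|]; rewrite ?mulr0// !mulr1.
rewrite (_ : below _ _ _ _ _ = true)//; apply/belowP => i mi.
rewrite (lt_le_trans (bm _ mi))// rmin_anti//.
by case/andP: nmM => /ltnW.
Qed.

Let ratio01 n m p : (n <= m)%N -> 0 <= ratio n m p <= 1.
Proof.
move=> nm; have h1 := rminS_le (u p) m; have h2 := rmin_anti (u p) nm.
rewrite /ratio; have [->|ne] := eqVneq (rmin (u p) n - rmin (u p) m.+1) 0.
  by rewrite invr0 mulr0 lexx ler01.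
have g0 : 0 < rmin (u p) n - rmin (u p) m.+1.
  by rewrite lt_neqAle eq_sym ne subr_ge0 (le_trans h1).
by rewrite divr_ge0 ?subr_ge0 ?(le_trans h1)//= ler_pdivrMr// mul1r lerD2r.
Qed.

Let obs_ratio n m : (n <= m)%N -> obs m.+1 (ratio n m).
Proof.
move=> nm; apply: obs_unit; last by move=> p; exact: ratio01.
move=> p q pq; rewrite /ratio (adapted_rmin pq).
rewrite (@adapted_rmin n p q); last by move=> i il; rewrite pq// (leq_trans il)// (leq_trans nm).
by rewrite (@adapted_rmin m p q)// => i il; rewrite pq// (leq_trans il).
Qed.

Let obs_cut_part n m : (n < m)%N -> obs m.+1 (fun p => (cut_part n m p)%:R : R).
Proof.
move=> nm; apply: obs_unit; last by move=> p; case: cut_part; rewrite ?lexx ?ler01.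
move=> p q pq; congr (nat_of_bool _)%:R.
have := @adapted_below n.+1 (m - n) (fun p => rmin (u p) n).
have -> : (n.+1 + (m - n) = m.+1)%N by lia.
by apply => //; apply: adaptedW (@adapted_rmin n); lia.
Qed.

(* Given the past up to [m + 1], the event [cut n] fails after having held so far with
   probability at most [h(X_(m+1)) / I_n], which the factor [s m] controls. *)
Let s_le_stay n m p : (n < m < M)%N -> cut_part n m p ->
  s m p <= (s m p + v n * ratio n m p) *
           fine (stay P h (M - m.+1) (rmin (u p) n) (p m.+1)).
Proof.
move=> /andP[nm mM] /belowP cp.
have vr0 : 0 <= v n * ratio n m p.
  by rewrite mulr_ge0//; case/andP: (ratio01 p (ltnW nm)).
have := s_ge0 m p; rewrite le_eqVlt => /predU1P[<-|sp].
  by rewrite add0r mulr_ge0// fine_ge0// stay_ge0.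
have [_ _ a0] := cweight_gt0 (u0 p) v01 delta0 sp.
have [I0 Il Iu] := decr_gt0 (u0 p) a0.
have Inm := rmin_anti (u p) (ltnW nm).
have In0 : 0 < rmin (u p) n by exact: lt_le_trans Inm.
apply: (@le_trans _ _ ((s m p + v n * ratio n m p) * (1 - h (p m.+1) / rmin (u p) n))).
  2: by rewrite ler_wpM2l ?addr_ge0// stay_ge.
rewrite -[h _]Iu /ratio.
have sm := s_le m p; have vmn := v_anti (ltnW nm).
have {sm} : s m p <= v n * decr (u p) m.
  by rewrite (le_trans sm)// ler_wpM2r// ltW.
rewrite /decr; move: (s m p) {sp} (s_ge0 m p) => sm sm0.
have J0 : 0 <= rmin (u p) m.+1 by exact: rmin_ge0.
move: In0 Inm Il I0 J0; move: (rmin (u p) n) (rmin (u p) m.+1) (rmin (u p) m) => a c b.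
move=> a0' ba cb b0 c0; move: (v n) (v0 n) => w w0 smw.
have ac : 0 < a - c by rewrite subr_gt0 (lt_le_trans cb).
(* It remains to see [sm * c <= w * (b - c)], which follows from [sm <= w * (b - c) / b] and
   [c <= b]. *)
have -> : (sm + w * ((b - c) / (a - c))) * (1 - c / a) =
    sm + (w * (b - c) - sm * c) / a by field; rewrite !gt_eqF.
rewrite lerDl divr_ge0 ?(ltW a0')// subr_ge0.
apply: (@le_trans _ _ (w * ((b - c) / b) * c)); first by rewrite ler_wpM2r.
rewrite -mulrA ler_wpM2l// mulrAC ler_pdivrMr//.
by apply: ler_wpM2l; rewrite ?subr_ge0 ltW.
Qed.

(** Conditioning at time [m + 1] replaces [y m * cut m] by [s m], so the two terms containing [s n]
    cancel. The other two differ only in that [cut n] is tested up to [m + 1] in one and up to [M]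
    in the other; [s_le_stay] bounds this difference. *)
Let E_cross n m : (n < m < M)%N ->
  E (fun p => D n p * D m p) <= E (fun p => y n p * cut n p * (v n * ratio n m p)).
Proof.
move=> nmM; have /andP[nm mM] := nmM; have nM := ltn_trans nm mM.
have os k : (k < M)%N -> obs M (s k) by move=> kM; exact: obsW (obs_s k).
have oyc k : (k < M)%N -> obs M (fun p => y k p * cut k p).
  by move=> kM; apply: obsM (obs_cut kM); exact: obsW (obs_y k).
pose cp p : R := (cut_part n m p)%:R.
have ocp : obs m.+1 cp by exact: obs_cut_part.
have oym : obs m.+1 (y n) by apply: obsW (obs_y n); exact: ltnW.
have osm : obs m.+1 (s n) by apply: obsW (obs_s n); exact: ltnW.
have cp0 p : 0 <= cp p by rewrite /cp.
have or : obs m.+1 (ratio n m) by exact: obs_ratio (ltnW nm).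
have r0 p : 0 <= ratio n m p by case/andP: (ratio01 p (ltnW nm)).
have osv : obs m.+1 (fun p => y n p * cp p * (s m p + v n * ratio n m p)).
  exact: (obsM (obsM oym ocp) (obsD (obs_s m) (obsM (obs_cst _ _ _) or))).
have E1 : E (fun p => y n p * cut n p * (y m p * cut m p)) =
          E (fun p => y n p * cp p * s m p).
  transitivity (E (fun p => y n p * cp p * y m p * cut m p)).
    by apply: eq_expect => p; rewrite mulrACA (cut_nested p nmM) -/(cp p); ring.
  rewrite E_cut; first by apply: eq_expect => p; rewrite -mulrA y_e.
    exact: (obsM (obsM oym ocp) (obs_y m)).
  by move=> p; apply: mulr_ge0 => //; exact: mulr_ge0.
have E2 : E (fun p => s n p * (y m p * cut m p)) = E (fun p => s n p * s m p).
  transitivity (E (fun p => s n p * y m p * cut m p)).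
    by apply: eq_expect => p; rewrite mulrA.
  rewrite E_cut; first by apply: eq_expect => p; rewrite -mulrA y_e.
    exact: (obsM osm (obs_y m)).
  by move=> p; exact: mulr_ge0.
have E3 : E (fun p => y n p * cp p * s m p) <=
    E (fun p => y n p * cut n p * (s m p + v n * ratio n m p)).
  have -> : E (fun p => y n p * cut n p * (s m p + v n * ratio n m p)) =
     E (fun p => (y n p * cp p * (s m p + v n * ratio n m p)) *
           (below h (rmin (u p) n) (M - m.+1) m.+1 p)%:R).
    apply: eq_expect => p; rewrite /cut (cut_split p nmM) /cp.
    by case: (cut_part n m p); case: below; rewrite /=; ring.
  rewrite /E (expect_below kP tX h); last 3 first.
  - by apply: adaptedW (@adapted_rmin n); lia.
  - exact: osv.1.
  - by move=> p; apply: mulr_ge0; [exact: mulr_ge0|apply: addr_ge0 => //; exact: mulr_ge0].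
  have ost : obs M (fun p => fine (stay P h (M - m.+1) (rmin (u p) n) (p m.+1))).
    apply: (@obsW _ _ m.+1) => //; apply: obs_unit.
      move=> p q pq; rewrite pq// (@adapted_rmin n p q)// => i il; apply: pq; lia.
    move=> p; rewrite fine_ge0 ?stay_ge0//= -lee_fin fineK ?stay_le1//.
    exact: stay_fin.
  apply: (@le_expect _ _ _ _ _ _ _ _ tX M).
  - exact: (obsW mM (obsM (obsM oym ocp) (obs_s m))).
  - exact: (obsM (obsW mM osv) ost).
  move=> p; have := @s_le_stay n m p nmM; rewrite /cp.
  move: (y n p) (y_ge0 n p) => z z0; case: (cut_part n m p) => [ssf|_].
    by rewrite !mulr1 -mulrA ler_wpM2l// ssf.
  by rewrite !mulr0 !mul0r.
have -> : E (fun p => D n p * D m p) =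
   E (fun p => y n p * cut n p * (y m p * cut m p)) - E (fun p => y n p * cut n p * s m p)
   - E (fun p => s n p * (y m p * cut m p)) + E (fun p => s n p * s m p).
  rewrite /E -!(@expectB _ _ _ _ _ _ _ _ tX M) -?(@expectD _ _ _ _ _ _ _ _ tX M).
  by apply: eq_expect => p; rewrite /D; ring.
  all: have [sn sm yn ym] := And4 (os _ nM) (os _ mM) (oyc _ nM) (oyc _ mM).
  - exact: (obsB (obsB (obsM yn ym) (obsM yn sm)) (obsM sn ym)).
  - exact: (obsM sn sm).
  - exact: (obsB (obsM yn ym) (obsM yn sm)).
  - exact: (obsM sn ym).
  - exact: (obsM yn ym).
  - exact: (obsM yn sm).
rewrite E2 subrK E1 lerBlDr; apply: (le_trans E3).
rewrite -(@expectD _ _ _ _ _ _ _ _ tX M); last 2 first.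
- exact: (obsM (oyc _ nM) (obsM (obs_cst _ _ _) (obsW mM or))).
- exact: (obsM (oyc _ nM) (os _ mM)).
rewrite le_eqVlt; apply/orP; left; apply/eqP.
by apply: eq_expect => p; ring.
Qed.

(** The telescoping bound gives [- ln a_n <= - ln (delta n)], and the factor [v n] brings it down to
    1. *)
Let sum_ratio_le n p : (n < M)%N ->
  y n p * cut n p * (v n * \sum_(n.+1 <= m < M) ratio n m p) <= y n p * cut n p.
Proof.
move=> nM.
have yc0 : 0 <= y n p * cut n p by apply: mulr_ge0 => //; case/andP: (cut01 n p).
have := y_ge0 n p; rewrite le_eqVlt => /predU1P[y0|/y_gt0 sp].
  by rewrite -y0 !mul0r.
have [_ da a0] := cweight_gt0 (u0 p) v01 delta0 sp.
have [_ Il _] := decr_gt0 (u0 p) a0.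
rewrite -[leRHS]mulr1; apply: ler_wpM2l => //.
rewrite (le_trans _ (vdelta n))// ler_wpM2l//.
rewrite (le_trans (sum_decr_ratio_le (u0 p) Il nM))// lerN2.
by rewrite ler_ln ?posrE.
Qed.

(** Induction from the last index downwards. Splitting off [D j] costs at most [2 E(s j)] for the
    square and [E(s j)] for the sum of all cross terms, which counts twice: hence the 4. *)
Let E_sqr_sumD k j : (j + k = M)%N ->
  E (fun p => (\sum_(j <= m < M) D m p) * (\sum_(j <= m < M) D m p)) <=
  4 * \sum_(j <= m < M) E (s m).
Proof.
elim: k j => [|k IH] j jk.
  rewrite addn0 in jk; rewrite jk big_geq// mulr0 -[leRHS](expect_cst Pr X).
  rewrite le_eqVlt; apply/orP; left; apply/eqP/eq_expect => p.
  by rewrite big_geq// mul0r.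
have jM : (j < M)%N by lia.
pose W p := \sum_(j.+1 <= m < M) D m p.
have oW : obs M W by apply: obs_sum => i /andP[_ iM]; exact: obs_D.
have oD := obs_D jM.
have -> : E (fun p => (\sum_(j <= m < M) D m p) * (\sum_(j <= m < M) D m p)) =
    E (fun p => D j p * D j p) + E (fun p => D j p * W p) * 2 + E (fun p => W p * W p).
{ rewrite mulr_natr mulr2n /E -!(@expectD _ _ _ _ _ _ _ _ tX M).
    by apply: eq_expect => p; rewrite big_ltn// -/(W p); ring.
  all: have [DD DW WW] := And3 (obsM oD oD) (obsM oD oW) (obsM oW oW).
  all: first [exact: DD|exact: DW|exact: WW|exact: (obsD DW DW)|
              exact: (obsD DD (obsD DW DW))]. }
have oyc : obs M (fun p => y j p * cut j p).
  by apply: obsM (obs_cut jM); exact: obsW (obs_y j).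
have DW : E (fun p => D j p * W p) <= E (s j).
  have oDD m : (j.+1 <= m < M)%N -> obs M (fun p => D j p * D m p).
    by move=> /andP[_ mM]; exact: (obsM oD (obs_D mM)).
  have orr m : (j.+1 <= m < M)%N -> obs M (fun p => y j p * cut j p * (v j * ratio j m p)).
    move=> /andP[jm mM]; apply: (obsM oyc (obsM (obs_cst _ _ _) _)).
    exact: obsW (obs_ratio (ltnW jm)).
  have -> : E (fun p => D j p * W p) = E (fun p => \sum_(j.+1 <= m < M) D j p * D m p).
    by apply: eq_expect => p; rewrite mulr_sumr.
  rewrite /E (expect_sum tX oDD).
  apply: (@le_trans _ _ (\sum_(j.+1 <= m < M)
      E (fun p => y j p * cut j p * (v j * ratio j m p)))).
    rewrite big_nat [leRHS]big_nat; apply: ler_sum => m /andP[jm mM].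
    by apply: E_cross; rewrite jm.
  rewrite /E -(expect_sum tX orr) -/E -E_ycut.
  apply: (le_expect tX (obs_sum orr) oyc) => p.
  by rewrite -mulr_sumr -mulr_sumr; exact: sum_ratio_le.
have := IH j.+1; rewrite addSnnS => /(_ jk) {}IH.
rewrite [in leRHS]big_ltn//; have := E_sqrD jM; move: IH DW; rewrite -/(W _); lra.
Qed.

Definition no_cut p : bool := (V <= total (u p) n0 v delta M) &&
  [forall n : 'I_M, (0 < cweight (u p) n0 v delta V n) ==>
      ~~ below h (rmin (u p) n) (M - n.+1) n.+1 p].

Lemma adapted_no_cut : adapted M no_cut.
Proof.
move=> p q pq; rewrite /no_cut (adapted_total pq); congr (_ && _).
apply: eq_forallb => n; congr (_ ==> ~~ _).
  by congr (_ < _); apply: adapted_s => i il; apply: pq; have := ltn_ord n; lia.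
have := adapted_cut (ltn_ord n) pq; rewrite /cut => /eqP.
by rewrite eqr_nat; do 2!case: below.
Qed.

(** Chebyshev's inequality: on the bad event every [y n * cut n] vanishes, so the sum of the [D n]
    is minus the sum of the [s n], at most [- V], while its second moment is at most
    [4 * (V + 1)]. *)
Lemma prob_no_cut :
  fine (Pr [set w | no_cut (X^~ w)]) * V ^+ 2 <= 4 * (V + 1).
Proof.
have aB := adapted_no_cut.
rewrite -(expect_indic tX aB) mulrC.
have oB : obs M (fun p => (no_cut p)%:R : R).
  apply: obs_unit; first by move=> p q pq; rewrite (aB p q pq).
  by move=> p; case: (no_cut p); rewrite ?lexx ?ler01.
rewrite -(expectZ tX _ oB).
have oW : obs M (fun p => \sum_(0 <= m < M) D m p).
  by apply: obs_sum => i /andP[_ iM]; exact: obs_D.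
apply: (@le_trans _ _ (E (fun p => (\sum_(0 <= m < M) D m p) * (\sum_(0 <= m < M) D m p)))).
  apply: (le_expect tX (obsM (obs_cst _ _ _) oB) (obsM oW oW)) => p.
  case: (boolP (no_cut p)) => [/andP[VT /forallP H]|_]; last by rewrite mulr0 -expr2 sqr_ge0.
  have -> : \sum_(0 <= m < M) D m p = - \sum_(0 <= m < M) s m p.
    rewrite -sumrN big_nat [RHS]big_nat; apply: eq_bigr => m /andP[_ mM].
    rewrite /D; have := y_ge0 m p; rewrite le_eqVlt => /predU1P[<-|yp].
      by rewrite mul0r sub0r.
    have /implyP/(_ (y_gt0 yp))/negbTE := H (Ordinal mM).
    by rewrite /cut /= => ->; rewrite mulr0 sub0r.
  rewrite mulr1 mulrNN -expr2 lerXn2r ?nnegrE ?sum_cweight_ge//.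
  by apply: sumr_ge0 => i _; exact: s_ge0.
rewrite (le_trans (@E_sqr_sumD M 0 (add0n _)))// ler_pM2l// -(expect_cst Pr X (V + 1)).
have os m : (0 <= m < M)%N -> obs M (s m) by move=> /andP[_ mM]; exact: obsW (obs_s m).
rewrite -(expect_sum tX os).
apply: (le_expect tX (obs_sum os) (obs_cst _ _ _)) => p.
exact: sum_cweight_le.
Qed.

End second_moment.

(** * From the second moment bound to an almost sure statement *)

Section almost_sure_cut.
Context (R : realType) (d : measure_display) (T : measurableType d)
  (Pr : probability T R) (Om : countType) (P : Om -> Om -> R) (x : Om)
  (X : nat -> T -> Om).
Hypothesis kP : stochastic_kernel P.
Hypothesis tX : markov_trajectory Pr P x X.
Variables (h : Om -> R) (v delta : nat -> R) (n0 : nat).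
Hypotheses (sh : superharmonic P h) (v01 : forall i, (0 <= v i <= 1)%R)
  (v_anti : forall m n, (m <= n)%N -> (v n <= v m)%R)
  (delta0 : forall i, (0 < delta i)%R)
  (vdelta : forall i, (v i * - ln (delta i) <= 1)%R).

Let u w : nat -> R := fun i => h (X i w).
Let B (k M : nat) : set T :=
  [set w | no_cut h v delta n0 k.+1%:R M (X^~ w)].

Let mB k M : measurable (B k M).
Proof.
rewrite /B; apply: (@measurable_adapted _ _ _ _ _ _ _ _ tX M bool _ (fun b => b)).
exact: adapted_no_cut.
Qed.

Let u0 w i : (0 <= u w i)%R. Proof. exact: sh.1. Qed.

Let B_nondecreasing k : nondecreasing_seq (B k).
Proof.
apply/nondecreasing_seqP => M; apply/subsetPset => w /andP[kT /forallP H].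
rewrite /B /= /no_cut; apply/andP; split.
  by rewrite (le_trans kT)//; exact: (@total_nondecreasing _ _ _ _ _ (u0 w) v01).
apply/forallP => n; apply/implyP => tn.
have [nM|Mn] := ltnP n M.
  have /implyP/(_ tn) := H (Ordinal nM); apply: contra => /belowP b.
  apply/belowP => i /andP[ni iM]; apply: b; rewrite ni (leq_trans iM)//.
  by rewrite leq_add2l /= leq_sub2r.
(* The only new index is [M], and its truncated weight is 0 because the total has already reached
   [k + 1]. *)
have nM : (n : nat) = M by have := ltn_ord n; lia.
by move: tn; rewrite /cweight nM [X in if X then _ else _]ltNge kT ltxx.
Qed.

Let prob_B k M : Pr (B k M) <= ((4 * (k.+2)%:R) / k.+1%:R ^+ 2)%:E.
Proof.
rewrite -[Pr _]fineK ?fin_num_measure// lee_fin ler_pdivlMr ?exprn_gt0//.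
rewrite -[k.+2]addn1 natrD.
exact: (prob_no_cut kP tX n0 M sh v01 v_anti delta0 vdelta (ler0n R k.+1)).
Qed.

Let prob_cupB k : Pr (\bigcup_M B k M) <= ((4 * (k.+2)%:R) / k.+1%:R ^+ 2)%:E.
Proof.
have cB := @nondecreasing_cvg_mu _ _ _ Pr (B k) (mB k) (bigcupT_measurable _ (mB k))
  (@B_nondecreasing k).
rewrite -(cvg_lim _ cB)//; apply: lime_le; first by apply/cvg_ex; eexists; exact: cB.
by near=> M; exact: prob_B.
Unshelve. all: by end_near. Qed.

(** A path with divergent total and no cut lies, for every [k], in [B k M] for large [M]; the unions
    over [M] have probability of order [1 / k]. *)
Lemma ae_exists_cut :
  {ae Pr, forall w, (forall V : R, exists n, (V <= total (u w) n0 v delta n)%R) ->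
    exists2 n, (n0 <= n)%N & forall i, (n < i)%N -> (u w i < rmin (u w) n)%R}.
Proof.
pose N := \bigcap_k \bigcup_M B k M.
have mN : measurable N.
  by apply: bigcapT_measurable => k; exact: bigcupT_measurable.
exists N; split=> //.
  apply/eqP; rewrite eq_le measure_ge0 andbT; apply/lee_addgt0Pr => e e0.
  rewrite add0e.
  (* [4 * (k + 2) <= 8 * (k + 1)], so the bound for [B k] is at most [8 / (k + 1) < e]. *)
  pose k := Num.trunc (8 / e).
  have ke : (8 / e < k.+1%:R)%R by exact: truncnS_gt.
  apply: (@le_trans _ _ (Pr (\bigcup_M B k M))).
    apply: le_measure; rewrite ?inE//; first exact: bigcupT_measurable.
    exact: bigcap_inf.
  rewrite (le_trans (prob_cupB k))// lee_fin ler_pdivrMr ?exprn_gt0//.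
  move: ke; rewrite ltr_pdivrMr//.
  rewrite -[k.+2]addn1 natrD; have : (1 <= k.+1%:R :> R)%R by rewrite ler1n.
  by move: (k.+1%:R)%R => z; nra.
move=> w /= /not_implyP[VT nc] k _.
have [m kT] := VT k.+1%:R.
have tn n : (0 < cweight (u w) n0 v delta k.+1%:R n)%R ->
    exists M0, forall M, (M0 <= M)%N ->
      ~~ below h (rmin (u w) n) (M - n.+1) n.+1 (X^~ w).
  move=> sn.
  have n0n : (n0 <= n)%N.
    by move: sn; rewrite /cweight; case: ifP; rewrite ?ltxx// => _; rewrite /weight; case: ifP; rewrite ?ltxx// => /andP[].
  have [i ni ui] : exists2 i, (n < i)%N & (rmin (u w) n <= u w i)%R.
    apply: contrapT => H; apply: nc; exists n => // i ni.
    by rewrite ltNge; apply/negP => ui; apply: H; exists i.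
  exists i => M iM; apply/negP => /belowP/(_ i); rewrite ltNge ui => H.
  by have := H ltac:(lia).
have /choice[f fP] : forall n, exists M0, (0 < cweight (u w) n0 v delta k.+1%:R n)%R ->
    forall M, (M0 <= M)%N -> ~~ below h (rmin (u w) n) (M - n.+1) n.+1 (X^~ w).
  move=> n.
  have [/tn[M0 HM]|_] := boolP (0 < cweight (u w) n0 v delta k.+1%:R n)%R.
    by exists M0.
  by exists 0%N.
(* This horizon exceeds [m], where the total has reached [k + 1], and every [f i] with [i < m];
   indices from [m] on have truncated weight 0. *)
pose M := (m + \sum_(i < m) f i)%N.
exists M => //; rewrite /B /= /no_cut.
have mM : (m <= M)%N by exact: leq_addr.
apply/andP; split; first by rewrite (le_trans kT)//; exact: (@total_nondecreasing _ _ _ _ _ (u0 w) v01).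
apply/forallP => n; apply/implyP => sn; apply: (fP n sn).
have [nm|mn] := ltnP n m.
  rewrite (@leq_trans (\sum_(i < m) f i))// ?leq_addl//.
  by rewrite (bigD1 (Ordinal nm))//= leq_addr.
move: sn; rewrite /cweight [X in if X then _ else _]ltNge.
by rewrite (le_trans kT) ?ltxx//; exact: (@total_nondecreasing _ _ _ _ _ (u0 w) v01).
Qed.

End almost_sure_cut.

(** * The truncated Green's function as a superharmonic function *)

Section green_function.
Context (R : realType) (Om : countType) (P : Om -> Om -> R).
Hypothesis kP : stochastic_kernel P.

Lemma kpow_ge0 n y z : 0 <= kpow P n y z.
Proof.
have [P0 _] := kP.
elim: n y z => [|n IH] y z /=; first by rewrite lee_fin ler0n.
by apply: esum_ge0 => t _; rewrite mule_ge0// lee_fin.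
Qed.

(** [kpow] splits off the last step; superharmonicity in the starting point requires splitting off
    the first. *)
Lemma kpowS n y z :
  kpow P n.+1 y z = \esum_(t in [set: Om]) ((P y t)%:E * kpow P n t z).
Proof.
have [P0 _] := kP.
elim: n y z => [|n IH] y z.
  have single a (b : Om -> \bar R) : (forall t, 0 <= b t) ->
      \esum_(t in [set: Om]) (((a == t)%:R)%:E * b t) = b a.
    move=> b0; rewrite -[RHS](@esum_set1 _ _ a (fun t => b t))// [RHS]esum_mkcond.
    apply: eq_esum => t _; have [->|/eqP ne] := eqVneq a t.
      by rewrite mem_set// mul1e.
    by rewrite memNset ?mul0e// => ta; exact: ne.
  rewrite /= (single y (fun t => (P t z)%:E)); last by move=> t; rewrite lee_fin.
  rewrite -[LHS](single z (fun t => (P y t)%:E)); last by move=> t; rewrite lee_fin.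
  by apply: eq_esum => t _; rewrite muleC eq_sym.
rewrite [LHS]/=; transitivity (\esum_(t in [set: Om]) \esum_(r in [set: Om])
    ((P y r)%:E * (kpow P n r t * (P t z)%:E))).
  apply: eq_esum => t _; rewrite -/(kpow P n.+1 y t) IH muleC -esumZl//.
    by apply: eq_esum => r _; rewrite muleC muleA.
  by move=> r; rewrite mule_ge0 ?kpow_ge0// lee_fin.
rewrite esumC.
  apply: eq_esum => r _; rewrite esumZl// => t.
  by rewrite mule_ge0 ?kpow_ge0// lee_fin.
by move=> t r; rewrite !mule_ge0 ?kpow_ge0// lee_fin.
Qed.

Lemma green_ge0 y o : 0 <= green P y o.
Proof. by apply: nneseries_ge0 => n _ _; exact: kpow_ge0. Qed.

(** Applying [P] shifts the series by one, which drops the nonnegative term of index 0. *)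
Lemma green_superharmonic y o :
  \esum_(z in [set: Om]) ((P y z)%:E * green P z o) <= green P y o.
Proof.
have [P0 _] := kP.
have -> : \esum_(z in [set: Om]) ((P y z)%:E * green P z o) =
    \sum_(0 <= n <oo) kpow P n.+1 y o.
  transitivity (\esum_(z in [set: Om]) \esum_(n in [set: nat])
      ((P y z)%:E * kpow P n z o)).
    apply: eq_esum => z _; rewrite /green nneseries_esumT; last by move=> n; exact: kpow_ge0.
    by rewrite -esumZl// => n; exact: kpow_ge0.
  rewrite esumC; last by move=> z n; rewrite mule_ge0 ?kpow_ge0// lee_fin.
  rewrite nneseries_esumT; last by move=> n; exact: kpow_ge0.
  by apply: eq_esum => n _; rewrite kpowS.
rewrite /green [leRHS]nneseries_recl//; last by move=> n _; exact: kpow_ge0.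
apply: (@le_trans _ _ (\sum_(1 <= n <oo) kpow P n y o)).
  rewrite -[leRHS](nneseries_addn 1); last by move=> n; exact: kpow_ge0.
  rewrite le_eqVlt; apply/orP; left; apply/eqP; apply: eq_eseriesr => n _.
  by rewrite addn1.
by rewrite leeDr// kpow_ge0.
Qed.

(** The pole comes first. Truncation at 1 preserves superharmonicity and gives a real value even
    where the Green's function is infinite. *)
Definition tgreen (o y : Om) : R := fine (mine (green P y o) 1).

Lemma tgreenE o y : (tgreen o y)%:E = mine (green P y o) 1.
Proof.
rewrite fineK// ge0_fin_numE; first by rewrite gt_min ltry orbT.
by rewrite le_min green_ge0 lee01.
Qed.

Lemma tgreen01 o y : (0 <= tgreen o y <= 1)%R.
Proof. by rewrite -!lee_fin tgreenE le_min green_ge0 lee01/= ge_min lexx orbT. Qed.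

Lemma tgreen_le o y : (tgreen o y)%:E <= green P y o.
Proof. by rewrite tgreenE ge_min lexx. Qed.

Lemma tgreen_diag o : tgreen o o = 1%R.
Proof.
apply: EFin_inj; rewrite tgreenE; apply: min_r.
rewrite /green nneseries_recl//; last by move=> n _; exact: kpow_ge0.
by rewrite [kpow _ 0 _ _]/= eqxx leeDl// nneseries_ge0// => n _ _; exact: kpow_ge0.
Qed.

Lemma superharmonic_tgreen o : superharmonic P (tgreen o).
Proof.
have [P0 P1] := kP; split=> [y|y]; first by case/andP: (tgreen01 o y).
rewrite tgreenE le_min; apply/andP; split.
  apply: le_trans (green_superharmonic y o).
  by apply: le_esum => z _; rewrite EFinM lee_wpmul2l ?lee_fin// tgreen_le.
rewrite -(P1 y); apply: le_esum => z _; rewrite lee_fin -[leRHS]mulr1 ler_wpM2l//.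
by case/andP: (tgreen01 o z).
Qed.

(** The terms [P y z * h z] are nonnegative and their sum is at most [h y = 0]. *)
Lemma superharmonic_eq0 (h : Om -> R) y z : superharmonic P h ->
  h y = 0%R -> (0 < P y z)%R -> h z = 0%R.
Proof.
move=> [h0 sh] hy Pyz; have [P0 _] := kP.
have : (P y z * h z)%:E <= (h y)%:E.
  apply: le_trans (sh y).
  rewrite -(@esum_set1 _ _ z (fun t => (P y t * h t)%:E)); last by rewrite lee_fin mulr_ge0.
  rewrite esum_mkcond; apply: le_esum => t _; case: ifP => // _.
  by rewrite lee_fin mulr_ge0.
rewrite hy lee_fin pmulr_rle0// => hz; apply/eqP.
by rewrite eq_le hz h0.
Qed.

End green_function.

(** * Almost surely no transition of probability zero is made *)

Section transitions.
Context (R : realType) (d : measure_display) (T : measurableType d)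
  (Pr : probability T R) (Om : countType) (P : Om -> Om -> R) (x : Om)
  (X : nat -> T -> Om).
Hypothesis kP : stochastic_kernel P.
Hypothesis tX : markov_trajectory Pr P x X.

Lemma ae_transition_gt0 : {ae Pr, forall w, forall n, (0 < P (X n w) (X n.+1 w))%R}.
Proof.
have [P0 _] := kP.
apply/ae_foralln => n.
pose A := [set w | (P (X n w) (X n.+1 w) == 0)%R].
have aA : adapted n.+1 (fun p : nat -> Om => (P (p n) (p n.+1) == 0)%R).
  by move=> p q pq; rewrite !pq.
have mA : measurable A.
  exact: (@measurable_adapted _ _ _ _ _ _ _ _ tX n.+1 bool _ (fun b => b) aA).
exists A; split=> //; last first.
  move=> w /=; rewrite lt_neqAle P0 andbT => /negP; rewrite negbK => /eqP e.
  by rewrite /A /= -e eqxx.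
rewrite -[LHS]/(Pr A) -[A]setIT -integral_indic//.
transitivity (\int[Pr]_w ((P (X n w) (X n.+1 w) == 0)%R%:R)%:E).
  apply: eq_integral => w _; rewrite indicE.
  by case: (boolP (_ == _)) => Aw; [rewrite mem_set|rewrite memNset//; exact/negP].
rewrite (@markov_step _ _ _ _ _ _ _ _ kP tX n
  (fun z p => ((P (p n) z == 0)%R%:R)%:E))//.
- apply: integral0_eq => w _; apply: esum1 => z _.
  by rewrite -EFinM; case: eqP => [->|_]; rewrite ?mul0r ?mulr0.
- by move=> z p q pq; rewrite pq.
Qed.

End transitions.

(** * Deterministic analysis of a single path *)

Section deterministic.
Context (R : realType).
Implicit Types (u a : nat -> R).
Local Open Scope ring_scope.

Definition has_cut u n0 : Prop :=
  exists2 n, (n0 <= n)%N & forall i, (n < i)%N -> u i < rmin u n.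

(** With these choices [v_n * ln (1 / delta_n)] equals 1 and the [delta_n] are summable; the shift
    by 4 keeps the logarithm at least 1. *)
Definition vlog (n : nat) : R := (2 * ln n.+4%:R)^-1.
Definition dlog (n : nat) : R := (n.+4%:R ^+ 2)^-1.

Lemma ln4_ge1 (n : nat) : 1 <= ln n.+4%:R :> R.
Proof.
have h : - ln 2 <= - 2^-1 :> R.
  rewrite -lnV ?posrE//; have := @le_ln1Dx R (- 2^-1).
  by rewrite (_ : 1 + - 2^-1 = 2^-1 :> R); [apply; lra|field].
apply: (@le_trans _ _ (2 * 2^-1)); first by rewrite divff.
apply: (@le_trans _ _ (2 * ln 2)); first by rewrite ler_pM2l// -lerN2.
rewrite mulr_natl -lnXn// ler_ln ?posrE ?exprn_gt0//.
by rewrite -natrX ler_nat.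
Qed.

Lemma vlog01 n : 0 <= vlog n <= 1.
Proof.
have l1 := ln4_ge1 n; have l0 : 0 < 2 * ln n.+4%:R :> R by lra.
by rewrite /vlog invr_ge0 ltW//= invf_le1//; lra.
Qed.

Lemma vlog_anti m n : (m <= n)%N -> vlog n <= vlog m.
Proof.
move=> mn; have := ln4_ge1 n; have := ln4_ge1 m => l1 l2.
rewrite /vlog lef_pV2 ?posrE; [|lra|lra].
by rewrite ler_pM2l// ler_ln ?posrE// ler_nat.
Qed.

Lemma dlog_gt0 n : 0 < dlog n. Proof. by rewrite invr_gt0 exprn_gt0. Qed.

Lemma vdlog n : vlog n * - ln (dlog n) <= 1.
Proof.
have l1 := ln4_ge1 n.
rewrite /dlog lnV ?posrE ?exprn_gt0// opprK.
have -> : ln (n.+4%:R ^+ 2) = 2 * ln n.+4%:R :> R by rewrite lnXn// mulr_natl.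
by rewrite mulVf//; apply/eqP; lra.
Qed.

(** The cut is the index just before the first zero of [u]: zeros persist, and the minimum up to
    that index is still positive. *)
Lemma has_cut_of_rmin0 u n0 : (forall i, 0 <= u i) ->
  (forall i, (i <= n0)%N -> 0 < u i) -> (forall i, u i = 0 -> u i.+1 = 0) ->
  ~ (forall n, 0 < rmin u n) -> has_cut u n0.
Proof.
move=> u0 un0 uS /existsNP[k /negP]; rewrite -leNgt => rk.
have ex0 : exists i, u i == 0.
  apply: contrapT => H; move: rk; apply/negP; rewrite -ltNge; apply: rmin_gt => i _.
  by rewrite lt_neqAle u0 andbT eq_sym; apply/negP => ui; apply: H; exists i.
have := ex_minnP ex0 => -[[|m] /eqP um mmin]; first by have := un0 0%N isT; rewrite um ltxx.
exists m; first by rewrite leqNgt; apply/negP => mn; have := un0 _ mn; rewrite um ltxx.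
have rm : 0 < rmin u m.
  apply: rmin_gt => i im; rewrite lt_neqAle u0 andbT eq_sym.
  by apply/negP => /mmin; rewrite ltnNge im.
move=> i mi; suff -> : u i = 0 by [].
rewrite -(subnK mi); elim: (i - m.+1)%N => [|j IH]; first by rewrite add0n.
by rewrite addSn; exact: uS.
Qed.

Lemma total_half_unbounded u n0 : (forall i, 0 <= u i) ->
  (forall N, exists2 n, (N <= n)%N & 2^-1 <= decr u n) ->
  forall V, exists n, V <= total u n0 (fun=> 1) (fun=> 2^-1) n.
Proof.
move=> u0 io V.
have v01 (i : nat) : 0 <= (1 : R) <= 1 by rewrite ler01 lexx.
(* The target is rounded up to a multiple of one half, the amount that each further large decrease
   contributes. *)
suff [n Hn] : exists n, (Num.trunc (2 * V)).+1%:R / 2 <=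
    total u n0 (fun=> 1) (fun=> 2^-1) n.
  exists n; apply: le_trans Hn; rewrite ler_pdivlMr// mulrC ltW//.
  exact: truncnS_gt.
elim: (Num.trunc _).+1 => [|k [n IH]].
  by exists 0%N; rewrite mul0r /total big_geq.
have [m mn am] := io (maxn n n0); exists m.+1.
rewrite /total big_nat_recr//= -/(total _ _ _ _ m).
have -> : k.+1%:R / 2 = k%:R / 2 + 2^-1 :> R by rewrite -[k.+1]addn1 natrD; field.
apply: lerD.
  apply: (le_trans IH); apply: (@total_nondecreasing _ _ _ _ _ u0 v01).
  by rewrite (leq_trans _ mn)// leq_maxl.
by rewrite /weight (leq_trans (leq_maxr n n0) mn) am mul1r.
Qed.

Lemma total_log_ge u n0 n : (forall i, 0 <= u i) ->
  \sum_(0 <= i < n) vlog i * decr u i <= total u n0 vlog dlog n + n0%:R + 1.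
Proof.
move=> u0.
(* [minn n n0] pays for the indices before [n0], each of weight at most 1; [1 - (n + 3)^-1] pays for
   the decreases below [dlog], since [(i + 4)^-2 <= (i + 3)^-1 - (i + 4)^-1]. *)
suff : \sum_(0 <= i < n) vlog i * decr u i <=
    total u n0 vlog dlog n + (minn n n0)%:R + (1 - n.+3%:R^-1).
  move=> /le_trans; apply; apply: lerD.
    by rewrite lerD2l ler_nat geq_minr.
  by rewrite lerBlDr lerDl invr_ge0.
elim: n => [|n IH].
  rewrite /total !big_geq// min0n addr0 add0r subr_ge0 invf_le1//.
  by rewrite ler1n.
rewrite big_nat_recr//= /total big_nat_recr//= -/(total _ _ _ _ _).
have vd0 : 0 <= vlog n * decr u n.
  by rewrite mulr_ge0 ?decr_ge0//; case/andP: (vlog01 n).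
have vd1 : vlog n * decr u n <= 1.
  by case/andP: (vlog01 n) => ? ?; rewrite mulr_ile1 ?decr_ge0 ?decr_le1.
have vd2 : vlog n * decr u n <= decr u n.
  by case/andP: (vlog01 n) => ? ?; rewrite ler_piMl ?decr_ge0.
have dl : dlog n <= n.+3%:R^-1 - n.+4%:R^-1.
  have -> : n.+3%:R = n.+4%:R - 1 :> R by rewrite -[n.+4]addn1 natrD addrK.
  have : 4 <= n.+4%:R :> R by rewrite ler_nat.
  rewrite /dlog; move: (n.+4%:R) => z z4.
  have -> : (z - 1)^-1 - z^-1 = (z * (z - 1))^-1.
    by field; apply/andP; split; apply/eqP; lra.
  by rewrite lef_pV2 ?posrE; nra.
have d0 := dlog_gt0 n.
have mm : (minn n n0)%:R <= (minn n.+1 n0)%:R :> R.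
  by rewrite ler_nat; lia.
suff : vlog n * decr u n <= weight u n0 vlog dlog n + ((minn n.+1 n0)%:R - (minn n n0)%:R) + dlog n.
  move: IH dl; move: (n.+3%:R^-1) (n.+4%:R^-1) (minn n n0)%:R (minn n.+1 n0)%:R.
  move: (total _ _ _ _ n) => z1 z2 z3 z4 z5; lra.
rewrite /weight; case: (boolP (n0 <= n)%N) => /= [_|]; last first.
  rewrite -ltnNge => nn0.
  rewrite (_ : minn n.+1 n0 = n.+1); last by lia.
  rewrite (_ : minn n n0 = n); last by lia.
  by rewrite -[n.+1]addn1 natrD; lra.
move: mm d0 vd2; move: (minn n n0)%:R (minn n.+1 n0)%:R => z1 z2 mm d0 vd2.
case: ifP => [_|/negbT]; first by lra.
by rewrite -ltNge; lra.
Qed.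

(* What remains of a path for which none of the three sources of cut times applies. *)
Lemma has_cut_or_summable u n0 : (forall i, 0 <= u i) ->
  (forall i, (i <= n0)%N -> 0 < u i) -> (forall i, u i = 0 -> u i.+1 = 0) ->
  ((forall V, exists n, V <= total u n0 (fun=> 1) (fun=> 2^-1) n) -> has_cut u n0) ->
  ((forall V, exists n, V <= total u n0 vlog dlog n) -> has_cut u n0) ->
  has_cut u n0 \/
  [/\ forall n, 0 < rmin u n,
      exists N, forall n, (N <= n)%N -> decr u n < 2^-1 &
      exists C, forall n, \sum_(0 <= i < n) decr u i / ln i.+4%:R <= C].
Proof.
move=> u0 un0 uS c1 c2.
have [|nc] := pselect (has_cut u n0); [by left|right]; split.
- by apply: contrapT => H; apply: nc; exact: has_cut_of_rmin0.
- apply: contrapT => /forallNP H; apply: nc; apply: c1; apply: total_half_unbounded => // N.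
  have /existsNP[n /not_implyP[Nn dn]] := H N.
  by exists n => //; rewrite leNgt; exact/negP.
apply: contrapT => /forallNP H; apply: nc; apply: c2 => V.
have /existsNP[n /negP] := H (2 * (V + n0%:R + 1)); rewrite -ltNge => Hn.
exists n; have := total_log_ge n0 n u0.
have -> : \sum_(0 <= i < n) vlog i * decr u i =
    2^-1 * \sum_(0 <= i < n) decr u i / ln i.+4%:R.
  rewrite mulr_sumr; apply: eq_bigr => i _; rewrite /vlog.
  have := ln4_ge1 i => l1; field.
  by apply/eqP; lra.
by move: Hn; lra.
Qed.

Lemma bounded_tail a (C : R) : (forall i, 0 <= a i) ->
  (forall n, \sum_(0 <= i < n) a i <= C) -> forall eps, 0 < eps ->
  exists N0, forall N M, (N0 <= N <= M)%N -> \sum_(N <= i < M) a i <= eps.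
Proof.
move=> a0 aC eps e0.
pose S := [set \sum_(0 <= i < n) a i | n in [set: nat]].
have supS : has_sup S.
  split; first by exists (\sum_(0 <= i < 0) a i); exists 0%N.
  by exists C => _ [n _ <-].
have [_ [N0 _ <-] HN] := sup_adherent e0 supS.
exists N0 => N M /andP[N0N NM].
have : \sum_(0 <= i < M) a i <= sup S by apply: sup_upper_bound => //; exists M.
rewrite (@big_cat_nat _ _ _ N)//= (@big_cat_nat _ _ _ N0)//=.
have : 0 <= \sum_(N0 <= i < N) a i by rewrite sumr_ge0.
by move: HN; lra.
Qed.

Lemma ln_unbounded (A : R) (N : nat) : exists2 n, (N <= n)%N & A < ln n%:R.
Proof.
pose m := Num.trunc (expR A).
exists (maxn N m.+1); first exact: leq_maxl.
rewrite -[ltLHS]expRK ltr_ln ?posrE ?expR_gt0 ?ltr0n ?leq_max ?orbT//.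
apply: (lt_le_trans (truncnS_gt _)); rewrite ler_nat; exact: leq_maxr.
Qed.

Lemma ln_add4_le n : (4 <= n)%N -> ln n.+4%:R <= ln n%:R + 1 :> R.
Proof.
move=> n4; have n0 : (0 : R) < n%:R by rewrite ltr0n; lia.
have : ln (n.+4%:R / n%:R) <= 1 :> R.
  have := @le_ln1Dx R (4 / n%:R).
  have -> : 1 + 4 / n%:R = n.+4%:R / n%:R :> R.
    by rewrite -[n.+4]addn4 natrD; field; rewrite gt_eqF.
  move=> /(_ _)/le_trans; apply; first by rewrite (@lt_trans _ _ 0)// divr_gt0.
  by rewrite ler_pdivrMr// mul1r ler_nat.
by rewrite ln_div ?posrE// lerBlDl addrC.
Qed.

(** As [a_i < 1/2], [- ln I] grows by [- ln (1 - a_i) <= 2 a_i] at step [i]. A small tail of the sum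
    of [a_i / ln (i + 4)] keeps this growth below [c * ln n], which polynomial decay with exponent
    [c] would require. *)
Lemma polynomial_not_summable u (C c : R) (N1 N2 : nat) : (forall i, 0 <= u i) ->
  (forall n, 0 < rmin u n) -> (forall n, (N1 <= n)%N -> decr u n < 2^-1) ->
  (forall n, \sum_(0 <= i < n) decr u i / ln i.+4%:R <= C) ->
  0 < c -> (forall n, (N2 <= n)%N -> u n <= n%:R `^ (- c)) -> False.
Proof.
move=> u0 r0 d12 dC c0 uc.
have ln0 i : 0 < ln i.+4%:R :> R by have := ln4_ge1 i; lra.
have a0 i : 0 <= decr u i / ln i.+4%:R by rewrite divr_ge0 ?decr_ge0// ltW.
(* The tail [c / 4], doubled by [logr], leaves [c / 2] in front of the logarithm, strictly less than
   [c]. *)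
have [N0 tail] := bounded_tail a0 dC (divr_gt0 c0 (ltr0n R 4)).
pose N := maxn N0 N1.
have sumd M : (N <= M)%N -> \sum_(N <= i < M) decr u i <= c / 4 * ln M.+4%:R.
  move=> NM; have tNM : \sum_(N <= i < M) decr u i / ln i.+4%:R <= c / 4.
    by apply: tail; rewrite leq_maxl.
  apply: (@le_trans _ _ ((\sum_(N <= i < M) decr u i / ln i.+4%:R) * ln M.+4%:R)).
    rewrite mulr_suml big_nat [leRHS]big_nat; apply: ler_sum => i /andP[_ iM].
    rewrite -mulrA ler_peMr ?decr_ge0// ler_pdivlMl// mulr1 ler_ln ?posrE//.
    by rewrite ler_nat; lia.
  by rewrite ler_pM2r.
have logr M : (N <= M)%N ->
    - ln (rmin u M) <= - ln (rmin u N) + 2 * \sum_(N <= i < M) decr u i.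
  elim: M => [|M IH] NM.
    by move: NM; rewrite leqn0 => /eqP ->; rewrite big_geq// mulr0 addr0.
  move: NM; rewrite leq_eqVlt => /predU1P[->|]; first by rewrite big_geq// mulr0 addr0.
  rewrite ltnS => NM; rewrite big_nat_recr//= mulrDr addrA -lerBlDr.
  apply: le_trans (IH NM).
  have dM : decr u M < 2^-1 by apply: d12; rewrite (leq_trans _ NM)// leq_maxr.
  have d0 := decr_ge0 M u0.
  have rS : rmin u M.+1 = rmin u M * (1 - decr u M).
    by rewrite /decr; field; rewrite gt_eqF.
  rewrite -[X in ln X]/(rmin u M.+1) rS lnM ?posrE//; last by lra.
  suff : - ln (1 - decr u M) <= 2 * decr u M by lra.
  rewrite -lnV ?posrE; last by lra.
  have := @le_ln1Dx R (decr u M / (1 - decr u M)).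
  have -> : 1 + decr u M / (1 - decr u M) = (1 - decr u M)^-1 by field; apply/eqP; lra.
  have q : decr u M / (1 - decr u M) <= 2 * decr u M.
    by rewrite ler_pdivrMr; nra.
  move=> /(_ _)/le_trans; apply => //.
  by rewrite (@lt_le_trans _ _ 0)// divr_ge0//; lra.
(* [M] is so large that [(c / 2) * ln M] exceeds the constant [- ln I_N] plus the cost [c / 2] of
   replacing [ln (M + 4)] by [ln M + 1]. *)
have [M NM] := ln_unbounded ((- ln (rmin u N) + c) / (c / 2)) (maxn N (maxn N2 4)).
have NM1 : (N <= M)%N by lia.
have NM2 : (N2 <= M)%N by lia.
have NM3 : (4 <= M)%N by lia.
have M0 : (0 : R) < M%:R by rewrite ltr0n; lia.
rewrite ltr_pdivrMr; last by lra.
have := logr _ NM1; have := sumd _ NM1; have := ln_add4_le NM3.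
have : c * ln M%:R <= - ln (rmin u M).
  rewrite lerNr -mulNr -ln_powR ler_ln ?posrE ?powR_gt0//.
  exact: le_trans (rmin_le _ _) (uc _ NM2).
by move: (ln M%:R) (ln M.+4%:R) (\sum_(_ <= _ < _) _) (ln (rmin u M)) (ln (rmin u N)) => l l4 s lM lN; nra.
Qed.

End deterministic.

(** * The integral criterion *)

Section integral_criterion.
Context (R : realType) (Phi Phiinv : R -> R).
Hypothesis Phi_decr : forall s t : R, (0 <= s)%R -> (s < t)%R -> (Phi t < Phi s)%R.
Hypothesis Phi_unit : forall t : R, (0 <= t)%R -> (0 < Phi t <= 1)%R.
Hypothesis PhiinvP : forall y : R, (0 < y <= 1)%R -> (0 <= Phiinv y)%R /\ Phi (Phiinv y) = y.

Let f (y : R) : R := ((y * Num.max 1 (ln (Phiinv y)))^-1)%R.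

Lemma Phiinv_anti (y z : R) : (0 < y <= 1)%R -> (0 < z <= 1)%R -> (y <= z)%R ->
  (Phiinv z <= Phiinv y)%R.
Proof.
move=> y01 z01 yz; rewrite leNgt; apply/negP => H.
have [y0 Py] := PhiinvP y01; have [_ Pz] := PhiinvP z01.
by have := Phi_decr y0 H; rewrite Py Pz ltNge yz.
Qed.

Lemma Phiinv_ge (y t : R) : (0 < y <= 1)%R -> (0 <= t)%R -> (y <= Phi t)%R ->
  (t <= Phiinv y)%R.
Proof.
move=> y01 t0 yt; rewrite leNgt; apply/negP => H.
have [y0 Py] := PhiinvP y01.
by have := Phi_decr y0 H; rewrite Py ltNge yt.
Qed.

Let I01 : set R := `]0%R, 1%R].

(** Preimages of the rays [[r, +oo)] within [(0, 1]] are intervals. *)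
Lemma measurable_antitone (g : R -> R) :
  (forall y z, (0 < y <= 1)%R -> (0 < z <= 1)%R -> (y <= z)%R -> (g z <= g y)%R) ->
  measurable_fun I01 g.
Proof.
move=> g_anti mI; apply: (measurability (@RGenCInfty.G R)) => [|/= _ [_] [r] -> <-|//].
  exact: RGenCInfty.measurableE.
apply: is_interval_measurable => s t /=; rewrite /I01 /= !in_itv/= !andbT.
move=> [s01 rs] [t01 rt] y /andP[sy yt].
have y01 : (0 < y <= 1)%R.
  by case/andP: s01 => s0 _; case/andP: t01 => _ t1; rewrite (lt_le_trans s0)// (le_trans yt).
split; rewrite /= !in_itv/= ?andbT//.
exact: le_trans rt (g_anti _ _ y01 t01 yt).
Qed.

Let den (y : R) : R := Num.max 1%R (ln (Phiinv y)).

Let den_ge1 y : (1 <= den y)%R. Proof. by rewrite /den le_max lexx. Qed.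

Let den_gt0 y : (0 < den y)%R. Proof. by rewrite (lt_le_trans ltr01). Qed.

Let den_anti y z : (0 < y <= 1)%R -> (0 < z <= 1)%R -> (y <= z)%R -> (den z <= den y)%R.
Proof.
move=> y01 z01 yz; rewrite /den ge_max le_max lexx/= le_max.
have [Pz|Pz] := ltP 0%R (Phiinv z); last by rewrite ln0// ler01.
rewrite ler_ln ?posrE//; first by rewrite Phiinv_anti// orbT.
exact: lt_le_trans Pz (Phiinv_anti y01 z01 yz).
Qed.

Let measurable_f : measurable_fun I01 (EFin \o f).
Proof.
apply/measurable_EFinP.
(* [den] is antitone, so [- 1 / den] is antitone as well, and the integrand becomes a product of
   measurable factors. *)
rewrite (_ : f = (fun y => y^-1 * - (- (den y)^-1)))%R; last first.
  by apply/funext => y; rewrite /f -/(den y) opprK invfM.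
apply: measurable_funM.
  apply: measurable_antitone => y z /andP[y0 _] /andP[z0 _] yz.
  by rewrite lef_pV2 ?posrE.
apply: measurable_funN; apply: measurable_antitone => y z y01 z01 yz.
by rewrite lerN2 lef_pV2 ?posrE// den_anti.
Qed.

Let f_ge0 y : I01 y -> 0 <= (f y)%:E.
Proof.
rewrite /I01 /= in_itv/= => /andP[y0 _].
by rewrite lee_fin /f invr_ge0 mulr_ge0// ltW// den_gt0.
Qed.

Let sub_I01 (a b : R) : (0 <= a)%R -> (b <= 1)%R -> `]a, b]%classic `<=` I01.
Proof.
move=> a0 b1 y; rewrite /I01 /= !in_itv/= => /andP[ay yb].
by rewrite (le_lt_trans a0)//= (le_trans yb).
Qed.

Let int_le (a b t : R) : (0 < a)%R -> (a <= b)%R -> (0 <= t)%R -> (b <= 1)%R ->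
  (forall y, (a < y <= b)%R -> (1 <= t * den y)%R) ->
  \int[lebesgue_measure]_(y in `]a, b]) (f y)%:E <= ((b - a) * (t / a))%:E.
Proof.
move=> a0 ab t0 b1 dt.
have sI := sub_I01 (ltW a0) b1.
apply: (@le_trans _ _ (\int[lebesgue_measure]_(y in `]a, b]) (cst (t / a)%:E y))).
  apply: ge0_le_integral => //.
  - by move=> y /sI; exact: f_ge0.
  - exact: (measurable_funS (measurable_itv _) sI measurable_f).
  move=> y; rewrite /= in_itv/= => /andP[ay yb]; rewrite lee_fin /f -/(den y).
  have y0 : (0 < y)%R by exact: lt_trans ay.
  rewrite invfM mulrC; apply: ler_pM.
  - by rewrite invr_ge0 ltW.
  - by rewrite invr_ge0 ltW.
  - by rewrite -[leLHS]mul1r ler_pdivrMr// dt// ay.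
  - by rewrite lef_pV2 ?posrE// ltW.
rewrite integral_cst//= lebesgue_measure_itv/= lte_fin.
move: ab; rewrite le_eqVlt => /predU1P[<-|ab]; first by rewrite ltxx mule0 subrr mul0r.
by rewrite ab -EFinB -EFinM mulrC.
Qed.

(** Put [J_n = I_n / K <= Phi n]. On [(J_(n+1), J_n]] one has [Phiinv y >= n], so this piece of the
    integral is at most a constant times [a_n / ln (n + 4)]. The sum of these is bounded and [J_n]
    tends to 0, so the whole integral would be finite. *)
Lemma integral_criterion_not_summable (u : nat -> R) (C K : R) (N1 N2 : nat) :
  (forall y : R, (0 < y <= 1)%R -> exists2 t : R, (0 <= t)%R & Phi t = y) ->
  \int[lebesgue_measure]_(y in `]0%R, 1%R]) (f y)%:E = +oo ->
  (forall i, 0 <= u i)%R ->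
  (forall n, 0 < rmin u n)%R -> (forall n, (N1 <= n)%N -> (decr u n < 2^-1)%R) ->
  (forall n, (\sum_(0 <= i < n) decr u i / ln i.+4%:R <= C)%R) ->
  (0 < K)%R -> (forall n, (N2 <= n)%N -> (u n <= K * Phi n%:R)%R) -> False.
Proof.
move=> Phi_onto foo u0 r0 d12 dC K0 uK.
pose J n := (rmin u n / K)%R.
have J0 n : (0 < J n)%R by rewrite divr_gt0.
have J_anti m n : (m <= n)%N -> (J n <= J m)%R.
  by move=> mn; rewrite ler_pM2r ?invr_gt0// rmin_anti.
have JPhi n : (N2 <= n)%N -> (J n <= Phi n%:R)%R.
  by move=> Nn; rewrite ler_pdivrMr// mulrC (le_trans (rmin_le _ _))// uK.
pose N := maxn 4 (maxn N1 N2).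
have NP n : (N <= n)%N -> [/\ (4 <= n)%N, (N1 <= n)%N & (N2 <= n)%N] by move=> Nn; split; lia.
have J1 n : (N <= n)%N -> (0 < J n <= 1)%R.
  move=> /NP[_ _ N2n]; rewrite J0 (le_trans (JPhi _ N2n))//.
  by have /andP[] := Phi_unit (ler0n R n).
(* The 4 is a product of two factors 2: [ln (n + 4) <= ln n + 1 <= 2 * den y], and [(J_n - J_(n+1))
   / J_(n+1) = a_n / (1 - a_n) <= 2 a_n] as [a_n < 1/2]. *)
have step n : (N <= n)%N ->
    \int[lebesgue_measure]_(y in `]J n.+1, J n]) (f y)%:E <=
    (4 * (decr u n / ln n.+4%:R))%:E.
  move=> Nn; have [n4 nN1 nN2] := NP _ Nn.
  have l1 := ln4_ge1 R n.
  have /andP[Jn0 Jn1] := J1 _ Nn.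
  have [/= JnS] := (J_anti _ _ (leqnSn n)).
  apply: (le_trans (@int_le _ _ (2 / ln n.+4%:R) (J0 _) JnS _ Jn1 _)).
  - by rewrite divr_ge0//; lra.
  - move=> y /andP[Jy yJ].
    have y01 : (0 < y <= 1)%R by rewrite (lt_trans (J0 n.+1))// (le_trans yJ).
    have ny : (n%:R <= Phiinv y)%R.
      by apply: Phiinv_ge => //; exact: le_trans yJ (JPhi _ nN2).
    have nR : (0 < n%:R :> R)%R by rewrite ltr0n; lia.
    have lny : (ln n%:R <= den y)%R.
      by rewrite /den le_max ler_ln ?posrE ?ny ?orbT// (lt_le_trans nR).
    have := ln_add4_le R n4; have := den_ge1 y => d1 l2.
    by rewrite mulrAC ler_pdivlMr ?mul1r; lra.
  rewrite lee_fin.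
  have dn : (decr u n < 2^-1)%R by exact: d12.
  have rS : (rmin u n.+1 = rmin u n * (1 - decr u n))%R.
    by rewrite /decr; field; rewrite gt_eqF.
  have -> : ((J n - J n.+1) * (2 / ln n.+4%:R / J n.+1) =
      (2 * decr u n / (1 - decr u n)) / ln n.+4%:R)%R.
    rewrite /J rS; field.
    by rewrite !gt_eqF//=; lra.
  rewrite mulrA ler_pM2r ?invr_gt0; last by lra.
  have := decr_ge0 n u0 => d0.
  by rewrite ler_pdivrMr; nra.
have bound n : (N <= n)%N ->
    \int[lebesgue_measure]_(y in `]J n, 1%R]) (f y)%:E <=
    ((1 - J N) * (1 / J N) + 4 * \sum_(N <= i < n) decr u i / ln i.+4%:R)%:E.
  elim: n => [|n IH].
    by rewrite /N; lia.
  rewrite leq_eqVlt => /predU1P[<-|].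
    rewrite big_geq// mulr0 addr0; have /andP[a b] := J1 _ (leqnn N).
    apply: int_le => // y _; by rewrite mul1r.
  rewrite ltnS => Nn; have /andP[Jn0 Jn1] := J1 _ Nn.
  have JS := J_anti _ _ (leqnSn n).
  have -> : `]J n.+1, 1%R]%classic = `]J n.+1, J n] `|` `]J n, 1%R] :> set R.
    by rewrite -itv_bndbnd_setU// bnd_simp.
  rewrite ge0_integral_setU//; last 3 first.
  - apply: (measurable_funS (measurable_itv _) _ measurable_f).
    by move=> y [] /sub_I01; apply => //; rewrite ltW.
  - by move=> y [] /sub_I01 h; apply: f_ge0; apply: h => //; rewrite ltW.
  - apply/disj_setPS => y /= []; rewrite !in_itv/= => /andP[_ yJ] /andP[Jy _].
    by move: Jy; rewrite ltNge yJ.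
  have sumE (a s t : R) : (a + 4 * (s + t) = 4 * t + (a + 4 * s))%R by ring.
  rewrite big_nat_recr//= sumE EFinD.
  by apply: leeD; [exact: step|exact: IH].
have sJ n : `]J (n + N)%N, 1%R]%classic `<=` I01 by apply: sub_I01 => //; exact: ltW.
(* The intervals exhaust [(0, 1]]: if [Phi t = y] and [n > t], then [J_n <= Phi n < y]. *)
have UJ : \bigcup_n `]J (n + N)%N, 1%R]%classic = I01.
  apply/seteqP; split; first by move=> y [n _]; exact: sJ.
  move=> y; rewrite /I01 /= in_itv/= => /andP[y0 y1].
  have [t t0 Pt] := Phi_onto y (introT andP (conj y0 y1)).
  exists (Num.trunc t).+1 => //=; rewrite in_itv/= y1 andbT.
  set n := ((Num.trunc t).+1 + N)%N.
  have Nn : (N <= n)%N by rewrite leq_addl.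
  have [_ _ N2n] := NP _ Nn.
  rewrite (le_lt_trans (JPhi _ N2n))// -Pt; apply: Phi_decr => //.
  by rewrite (lt_le_trans (truncnS_gt t))// ler_nat leq_addr.
have cvI : \int[lebesgue_measure]_(y in `]J (n + N)%N, 1%R]) (f y)%:E @[n --> \oo] --> +oo.
  rewrite -foo -/I01 -UJ; apply: ge0_nondecreasing_set_cvg_integral.
  - apply/nondecreasing_seqP => n; apply/subsetPset => y; rewrite /= !in_itv/=.
    by move=> /andP[Jy ->]; rewrite andbT; apply: le_lt_trans Jy; apply: J_anti; lia.
  - by move=> i; exact: measurable_itv.
  - by move=> i; exact: (measurable_funS (measurable_itv _) (sJ i) measurable_f).
  - by move=> i y /sJ; exact: f_ge0.
have : +oo <= ((1 - J N) * (1 / J N) + 4 * C)%:E :> \bar R.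
  rewrite -(cvg_lim _ cvI)//; apply: lime_le; first by apply/cvg_ex; eexists; exact: cvI.
  near=> n; apply: (le_trans (bound _ _)); first by rewrite leq_addl.
  rewrite lee_fin lerD2l ler_pM2l//; apply: le_trans (dC (n + N)%N).
  rewrite (@big_cat_nat _ _ _ N 0)//= ?leq_addl// lerDr sumr_ge0// => i _.
  by rewrite divr_ge0 ?decr_ge0//; have := ln4_ge1 R i; lra.
by rewrite leNgt ltry.
Unshelve. all: by end_near. Qed.

End integral_criterion.

(** * Cut times of the trajectory *)

Section conclusion.
Context (R : realType) (d : measure_display) (T : measurableType d)
  (Pr : probability T R) (Om : countType) (P : Om -> Om -> R) (x : Om)
  (X : nat -> T -> Om).
Hypothesis kP : stochastic_kernel P.
Hypothesis tX : markov_trajectory Pr P x X.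

Lemma ae_forall_count (I : countType) (Q : I -> T -> Prop) :
  (forall i, {ae Pr, forall w, Q i w}) -> {ae Pr, forall w, forall i, Q i w}.
Proof.
move=> aQ; have : {ae Pr, forall w, forall k : nat,
    if pickle_inv k is Some i then Q i w else True}.
  by apply/ae_foralln => k; case: pickle_inv => [i|]; [exact: aQ|exact: aeW].
by apply: filterS => w Qw i; have := Qw (pickle i); rewrite pickleK_inv.
Qed.

Let u w n0 : nat -> R := fun i => tgreen P (X n0 w) (X i w).

(** A state visited both by time [n] and later would have a potential at least the minimum up to
    [n], against the strict bound after [n]. *)
Lemma cut_time_of_has_cut w n0 : has_cut (u w n0) n0 ->
  exists2 n, (n0 <= n)%N & cut_time (fun k => X k w) n.
Proof.
move=> [n n0n cut]; exists n => //; rewrite /cut_time.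
apply/seteqP; split=> // z [[i /= i_n <-] [j /= nj Xji]].
have := cut j nj; apply/negP; rewrite -leNgt {2}/u Xji.
exact: (rmin_le_all (u w n0) i_n).
Qed.

Lemma infinite_set_nat (S : set nat) :
  (forall m, exists2 n, (m <= n)%N & S n) -> infinite_set S.
Proof.
move=> Sm /finite_fsetP[F SF].
have [n mn] := Sm (\max_(i <- finmap.enum_fset F) i).+1; rewrite SF /= => nF.
by have := @leq_bigmax_seq _ (finmap.enum_fset F) xpredT id n nF isT; rewrite leqNgt mn.
Qed.

Lemma ae_cut_or_summable : {ae Pr, forall w, forall n0,
  has_cut (u w n0) n0 \/
  [/\ forall n, (0 < rmin (u w n0) n)%R,
      exists N, forall n, (N <= n)%N -> (decr (u w n0) n < 2^-1)%R &
      exists C : R, forall n, (\sum_(0 <= i < n) decr (u w n0) i / ln i.+4%:R <= C)%R]}.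
Proof.
(* The pole [X_n0] is random, so the almost sure statement is first obtained for all of the
   countably many deterministic poles [o] at once. *)
pose cuts v delta w (n0 : nat) (o : Om) :=
  (forall V : R, exists n,
    (V <= total (fun i => tgreen P o (X i w)) n0 v delta n)%R) ->
  has_cut (fun i => tgreen P o (X i w)) n0.
have ae_cuts v delta : (forall i, (0 <= v i <= 1)%R) ->
    (forall m n, (m <= n)%N -> (v n <= v m)%R) -> (forall i, (0 < delta i)%R) ->
    (forall i, (v i * - ln (delta i) <= 1)%R) ->
    {ae Pr, forall w, forall n0 o, cuts v delta w n0 o}.
  move=> v01 va d0 vd; apply: ae_forall_count => n0; apply: ae_forall_count => o.
  exact: (ae_exists_cut kP tX n0 (superharmonic_tgreen kP o) v01 va d0 vd).
have ae1 : {ae Pr, forall w, forall n0 o, cuts (fun=> 1%R) (fun=> 2^-1%R) w n0 o}.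
  apply: ae_cuts => //; first by move=> _; rewrite ler01 lexx.
  move=> _; rewrite lnV ?posrE// opprK mul1r.
  by have := @le_ln1Dx R 1; apply; lra.
have ae2 := ae_cuts _ _ (@vlog01 R) (@vlog_anti R) (@dlog_gt0 R) (@vdlog R).
apply: filterS3 (ae_transition_gt0 kP tX) ae1 ae2 => w tw c1 c2 n0.
have uS i : u w n0 i = 0%R -> u w n0 i.+1 = 0%R.
  move=> ui; exact: (superharmonic_eq0 kP (superharmonic_tgreen kP _) ui (tw i)).
have u0 i : (0 <= u w n0 i)%R by case/andP: (tgreen01 kP (X n0 w) (X i w)).
apply: has_cut_or_summable => //; [|exact: c1|exact: c2].
(* A zero at some [i <= n0] would persist until [n0], where the chain sits at the pole and the
   potential is 1. *)
move=> i i0; rewrite lt_neqAle u0 andbT eq_sym; apply/eqP => ui.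
have : u w n0 n0 = 0%R.
  by rewrite -[X in u w n0 X](subnK i0); elim: (n0 - i)%N => [|j IH]; [rewrite add0n|rewrite addSn; exact: uS].
by move/eqP; rewrite /u tgreen_diag// oner_eq0.
Qed.

Lemma limn_esup_bounded (g : nat -> \bar R) (phi : nat -> R) :
  (forall n, 0 <= g n) -> (forall n, (0 < phi n)%R) ->
  limn_esup (fun n => g n * ((phi n)^-1)%:E) < +oo ->
  exists K N, (0 < K)%R /\ forall n, (N <= n)%N -> g n <= (K * phi n)%:E.
Proof.
move=> g0 phi0; set v := (fun n => _); rewrite limn_esup_lim (cvg_lim _ (@cvg_esups_inf _ v))//.
move=> /ereal_inf_lt[_ [N _ <-] Nv].
have v0 n : 0 <= v n by rewrite mule_ge0// lee_fin invr_ge0 ltW.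
have vN n : (N <= n)%N -> v n <= esups v N.
  by move=> Nn; apply: ereal_sup_ubound; exists n.
have fN : esups v N \is a fin_num by rewrite ge0_fin_numE// (le_trans (v0 N))// vN.
have K0 : (0 <= fine (esups v N))%R by rewrite fine_ge0// (le_trans (v0 N))// vN.
(* The supremum of the tail may be 0; adding 1 makes the constant positive. *)
exists (fine (esups v N) + 1)%R, N; split; first by rewrite ltr_wpDl.
move=> n Nn; have := vN n Nn; rewrite /v lee_pdivrMr// => /le_trans; apply.
by rewrite EFinM -[X in X * _](fineK fN) -!EFinM lee_fin ler_pM2r// lerDl.
Qed.

End conclusion.

Theorem theorem1p1 (R : realType) (d : measure_display) (T : measurableType d)
  (Pr : probability T R) (Om : countType) (P : Om -> Om -> R) (x : Om)
  (X : nat -> T -> Om) :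
  stochastic_kernel P ->
  markov_trajectory Pr P x X ->
  (forall (Phi Phiinv : R -> R),
     (* Phi is a decreasing bijection [0,oo) -> (0,1] *)
     (forall s t : R, (0 <= s)%R -> (s < t)%R -> (Phi t < Phi s)%R) ->
     (forall t : R, (0 <= t)%R -> (0 < Phi t <= 1)%R) ->
     (forall u : R, (0 < u <= 1)%R -> exists2 t : R, (0 <= t)%R & Phi t = u) ->
     (* Phiinv is the inverse function of Phi *)
     (forall u : R, (0 < u <= 1)%R -> (0 <= Phiinv u)%R /\ Phi (Phiinv u) = u) ->
     (\int[lebesgue_measure]_(u in `]0%R, 1%R])
        ((u * Num.max 1 (ln (Phiinv u)))^-1)%:E = +oo) ->
     (forall m : nat, {ae Pr, forall w,
        limn_esup (fun n => green P (X n w) (X m w) * ((Phi n%:R)^-1)%:E) < +oo}) ->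
     {ae Pr, forall w, infinite_set [set n | cut_time (fun k => X k w) n]}) /\
  ((forall m : nat, {ae Pr, forall w,
      decays_polynomially (fun n => green P (X n w) (X m w))}) ->
   {ae Pr, forall w, infinite_set [set n | cut_time (fun k => X k w) n]}).
Proof.
move=> kP tX; have aecut := ae_cut_or_summable kP tX.
have u0 w m i : (0 <= tgreen P (X m w) (X i w))%R.
  by case/andP: (tgreen01 kP (X m w) (X i w)).
split=> [Phi Phiinv Phi_decr Phi_unit Phi_onto PhiinvP intoo lims|decay].
  apply: filterS2 aecut (ae_foralln lims) => w cs bd.
  (* Using [m] as the base time [n0] gives a cut time not before [m]; the other alternative
     contradicts the decay of the Green's function with pole [X_m]. *)
  apply: infinite_set_nat => m.
  have [/cut_time_of_has_cut//|[r0 [N1 dN1] [C dC]]] := cs m.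
  exfalso; have Phi0 n : (0 < Phi n%:R)%R by have /andP[] := Phi_unit _ (ler0n R n).
  have [K [N2 [K0 gK]]] := limn_esup_bounded (fun n => green_ge0 kP (X n w) (X m w)) Phi0 (bd m).
  apply: (integral_criterion_not_summable Phi_decr Phi_unit PhiinvP Phi_onto intoo
    (u0 w m) r0 dN1 dC K0 (N2 := N2)) => n Nn.
  by rewrite -lee_fin; apply: le_trans (gK n Nn); exact: tgreen_le.
apply: filterS2 aecut (ae_foralln decay) => w cs dc.
apply: infinite_set_nat => m.
have [/cut_time_of_has_cut//|[r0 [N1 dN1] [C dC]]] := cs m.
exfalso; have [c [c0 [N2 gN2]]] := dc m.
apply: (polynomial_not_summable (u0 w m) r0 dN1 dC c0 (N2 := N2)) => n Nn.
by rewrite -lee_fin; apply: le_trans (gN2 n Nn); exact: tgreen_le.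
Qed.
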